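(* Let $(X,f)$ be a dynamical system with $f$ a +proper relation. (1) The set of all Lyapunov functions for $f$ is sufficient. (2) If $\mathcal L$ is a sufficient set of Lyapunov functions for $f$ and $\mathcal A$ is the closed subalgebra of $\mathcal B(X)$ generated by $\mathcal L$ together with the continuous functions of compact support, then the associated compactification $(\hat X,\hat f)$ (called the $\mathcal L$ compactification) is a proper dynamic compactification of $(X,f)$. (3) Let $\mathcal L$ be a sufficient set of Lyapunov functions for $f$ and $(\hat X,\hat f)$ the associated $\mathcal L$ compactification. If $\hat E\subset|\mathcal G\hat f|$ is a $\mathcal G\hat f\cap\mathcal G\hat f^{-1}$ equivalence class and $E=\hat E\cap X$, then exactly one of the following three possibilities holds: (i) $\hat E$ consists of a single point of $\hat X\setminus X$. (ii) $E$ is contained in $|\mathcal Gf|$ and is a noncompact $\mathcal Gf\cap\mathcal Gf^{-1}$ equivalence class with $\hat E$ its one point compactification; that is, there is a noncompact equivalence class $E\subset|\mathcal Gf|$ whose closure in $\hat X$ is $\hat E$, and $\hat E\setminus E$ is a singleton. (iii) $\hat E=E$ is contained in $|\mathcal Gf|$ and is a compact $\mathcal Gf\cap\mathcal Gf^{-1}$ equivalence class. (4) If $X$ is metrizable, there exists a countable sufficient set $\mathcal L$ of Lyapunov functions for $f$, and the space $\hat X$ of the $\mathcal L$ compactification is metrizable.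
   Context: A space is a locally compact, $\sigma$-compact Hausdorff space. A relation $f$ on $X$ is a subset of $X\times X$; $f(x)=\{y:(x,y)\in f\}$, $f(A)=\bigcup_{x\in A}f(x)$, $f^{-1}=\{(y,x):(x,y)\in f\}$, $|f|=\{x:(x,x)\in f\}$, $1_X=\{(x,x)\}$. $f$ is closed if closed in $X\times X$; +proper if closed and $f(A)$ is compact for every compact $A\subset X$. A dynamical system $(X,f)$ is a space $X$ with a closed relation $f$ on it. $\mathcal Gf$ is the smallest closed transitive relation on $X$ containing $f$; $\mathcal Gf^{-1}=(\mathcal Gf)^{-1}$. $\mathcal Gf\cap\mathcal Gf^{-1}$ restricts to an equivalence relation on $|\mathcal Gf|$, whose classes are the $\mathcal Gf\cap\mathcal Gf^{-1}$ equivalence classes. $\mathcal B(X)$ is the Banach algebra of bounded continuous real-valued functions on $X$ with the sup norm. A proper compactification of $X$ is a compact Hausdorff space $\hat X$ containing $X$ as a dense (hence open) topological subspace; it is associated with the closed subalgebra $\mathcal A\subset\mathcal B(X)$ of all functions which extend continuously to $\hat X$, and conversely every closed subalgebra $\mathcal A$ (containing the constants) which distinguishes points from closed sets is associated with a proper compactification, unique up to homeomorphism (Gelfand space). Given it, $\hat f$ is the closure of $f$ in $\hat X\times\hat X$. $(\hat X,\hat f)$ is a dynamic compactification of $(X,f)$ if it is proper and $\mathcal G\hat f\cap(X\times X)=\mathcal Gf$. A Lyapunov function for $f$ is $L\in\mathcal B(X)$ such that $(x,y)\in f$ implies $L(x)\le L(y)$. Put $\le_L=\{(x,y):L(x)\le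 L(y)\}$. A set $\mathcal L$ of Lyapunov functions for $f$ is sufficient if $1_X\cup\mathcal Gf=\bigcap_{L\in\mathcal L}\le_L$. *)

(* Defs.v *)
From HB Require Import structures.
From mathcomp Require Import all_boot all_order all_algebra.
From mathcomp Require Import all_classical all_reals all_analysis.

Set Implicit Arguments.
Unset Strict Implicit.
Unset Printing Implicit Defensive.

Import Order.TTheory GRing.Theory Num.Theory.
Import numFieldNormedType.Exports.

Local Open Scope classical_set_scope.
Local Open Scope ring_scope.

Section Topology.

Definition sigma_compact (X : topologicalType) :=
  exists2 K : nat -> set X, forall n, compact (K n) & \bigcup_n K n = [set: X].

(* The equation on open sets says that X has the topology induced from Y
   along i; in particular it contains the continuity of i. *)
Definition topological_embedding (X Y : topologicalType) (i : X -> Y) :=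
  injective i /\ @open X = [set i @^-1` V | V in @open Y].

Definition homeomorphism (X Y : topologicalType) (h : X -> Y) :=
  topological_embedding h /\ range h = [set: Y].

Definition metrizable (R : realType) (X : topologicalType) :=
  exists (M : metricType R) (h : X -> M), homeomorphism h.

End Topology.

Section Relations.
Variable X : topologicalType.
Implicit Types f g : set (X * X).

Definition rel_image f (A : set X) : set X := \bigcup_(x in A) xsection f x.

Definition rel_fix f : set X := [set x | f (x, x)].

Definition rel_trans f := forall x y z, f (x, y) -> f (y, z) -> f (x, z).

Definition plus_proper f :=
  closed f /\ forall A, compact A -> compact (rel_image f A).

Definition Grel f : set (X * X) :=
  smallest [set g | closed g /\ rel_trans g] f.

Definition Gclass f (E : set X) :=
  exists2 x, rel_fix (Grel f) x & E = xsection (Grel f `&` ((Grel f)^-1)%relation) x.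

End Relations.

Section Functions.
Variables (R : realType) (X : topologicalType).
Implicit Types (u v L : X -> R) (A LL : set (X -> R)) (f : set (X * X)).

Definition bounded_continuous : set (X -> R) :=
  [set u | continuous u /\ bounded_fun u].

Definition compactly_supported : set (X -> R) :=
  [set u | continuous u /\ compact (closure [set x | u x != 0])].

(* On bounded functions the topology of {uniform X -> R} is that of the sup
   norm, and the bounded continuous functions are closed in it. *)
Definition closed_subalgebra A :=
  [/\ A `<=` bounded_continuous,
      forall c : R, A (cst c),
      forall (c : R) u, A u -> A (fun x => c * u x),
      forall u v, A u -> A v -> A (u \+ v) /\ A (u \* v) &
      closed (A : set {uniform X -> R})].

Definition lyapunov f : set (X -> R) :=
  [set L | bounded_continuous L /\ forall x y, f (x, y) -> L x <= L y].

Definition le_rel L : set (X * X) := [set p | L p.1 <= L p.2].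

Definition sufficient f LL :=
  LL `<=` lyapunov f /\ diagonal `|` Grel f = \bigcap_(L in LL) le_rel L.

Definition lyapunov_algebra LL : set (X -> R) :=
  smallest closed_subalgebra (LL `|` compactly_supported).

End Functions.

Section Compactifications.
Variables (R : realType) (X Y : topologicalType) (i : X -> Y).
Implicit Types (A LL : set (X -> R)) (f : set (X * X)) (E : set Y).

(* A compactification of X is given as a space Y together with the inclusion
   i : X -> Y, and subsets of X are identified with their images under i. *)
Definition proper_compactification :=
  [/\ compact [set: Y], hausdorff_space Y,
      topological_embedding i & dense (range i)].

Definition extendable : set (X -> R) :=
  [set u | bounded_continuous u /\
           exists2 v : Y -> R, continuous v & forall x, v (i x) = u x].

Definition associated_compactification A :=
  proper_compactification /\ extendable = A.

Definition lyapunov_compactification LL :=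
  associated_compactification (lyapunov_algebra LL).

Definition hat_rel f : set (Y * Y) := closure [set (i p.1, i p.2) | p in f].

Definition dynamic_compactification f :=
  proper_compactification /\
  [set p | Grel (hat_rel f) (i p.1, i p.2)] = Grel f.

Definition class_at_infinity E :=
  exists2 p, ~ range i p & E = [set p].

Definition class_one_point_compactification f E :=
  [/\ i @^-1` E `<=` rel_fix (Grel f), Gclass f (i @^-1` E),
      ~ compact (i @^-1` E), closure (i @` (i @^-1` E)) = E &
      exists p, E `\` i @` (i @^-1` E) = [set p]].

Definition class_compact f E :=
  [/\ E = i @` (i @^-1` E), i @^-1` E `<=` rel_fix (Grel f),
      Gclass f (i @^-1` E) & compact (i @^-1` E)].

End Compactifications.

Arguments extendable R {X Y} i.

Definition exactly_one_of_three (P Q S : Prop) :=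
  [\/ [/\ P, ~ Q & ~ S], [/\ ~ P, Q & ~ S] | [/\ ~ P, ~ Q & S]].

(* Main.v *)
(* By Nachbin's method: for the closed preorder [1 ∪ Gf] a closed lower set P
   inside an open lower set O can be separated by a pair P ⊆ U ⊆ D ⊆ O, with U
   open and D closed, both lower; the pair is built along a countable cover by
   compact sets, adding at each stage the lower set of a compact neighborhood.
   Iterating as in Urysohn's lemma gives enough Lyapunov functions.
   The compactification is the closure of the image of X in the product of
   lines indexed by the algebra, and Stone-Weierstrass identifies the functions
   that extend.  A sufficient set extends to the compactification, which gives
   [G f^] ∩ (X × X) ⊆ 1 ∪ Gf; on the diagonal one splits off the first step of
   [G f^], which stays in X because f is +proper.
   Compactly supported functions vanish at infinity, so the extended Lyapunov
   functions alone separate the points at infinity; being constant on classes,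
   they leave at most one such point in each class.  That point is not isolated
   in a class E meeting X: otherwise E ∩ X would be compact, while a chain
   leaving a compact neighborhood W of it must visit (W ∪ f(W)) \ int W,
   which lies in X and misses E.
   In the metrizable case, countably many Lyapunov functions and bumps separate
   the points of the compactification. *)
From HB Require Import structures.
Require Import Defs.
From mathcomp Require Import all_boot all_order all_algebra.
From mathcomp Require Import all_classical all_reals all_analysis.
From mathcomp Require Import lra.

Set Implicit Arguments.
Unset Strict Implicit.
Unset Printing Implicit Defensive.

Import Order.TTheory GRing.Theory Num.Theory.
Import numFieldNormedType.Exports.

Local Open Scope classical_set_scope.
Local Open Scope ring_scope.

(** * Compactness *)

(* Compactness as a way to choose one index for a whole compact set, when a
   local choice exists and indices can be merged. *)
Lemma compact_directed (Y : topologicalType) (T : Type) (K : set Y) (D : set T)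
    (le : T -> T -> Prop) (P : T -> Y -> Prop) :
  compact K -> (forall a b c, le a b -> le b c -> le a c) -> D !=set0 ->
  (forall a b, D a -> D b -> exists2 c, D c & le a c /\ le b c) ->
  (forall a b y, le a b -> P a y -> P b y) ->
  (forall y, K y -> exists2 a, D a & \forall y' \near y, P a y') ->
  exists2 a, D a & forall y, K y -> P a y.
Proof.
move=> /compact_near_coveringP cK le_tr [d Dd] dir mono loc.
(* The tails of [D] form a filter of indices. They use the reflexive closure of [le], since [le] is
   only assumed transitive. *)
pose F := filter_from D (fun a => [set b | D b /\ (a = b \/ le a b)]).
have FF : Filter F.
  apply: filter_from_filter; first by exists d.
  move=> a b Da Db; have [c Dc [ac bc]] := dir _ _ Da Db; exists c => //.
  move=> c' [Dc' cc']; split; split=> //; right.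
    by case: cc' => [<- //|]; exact: le_tr.
  by case: cc' => [<- //|]; exact: le_tr.
have [a Da aK] : \forall a \near F, K `<=` P a.
  apply: cK => y Ky; have [a Da ya] := loc y Ky.
  exists (P a, [set b | D b /\ (a = b \/ le a b)]); first by split=> //; exists a.
  move=> [y' b] /= [ay' [_ [<- //|ab]]]; exact: mono ab ay'.
by exists a => //; apply: (aK a); split=> //; left.
Qed.

Section CompactTopology.
Variables X Y : topologicalType.

(** Tube argument: if no point of [A] is related to [y], compactness of [A] yields one neighborhood
    of [y] that is related to no point of [A]. *)
Lemma compact_rel_closed (G : set (X * Y)) (A : set X) :
  compact A -> closed G -> closed [set y | exists2 x, A x & G (x, y)].
Proof.
move=> /compact_near_coveringP cA /closed_openC oG; rewrite -openC openE => y yA.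
suff : \forall y' \near y, A `<=` (fun x => ~ G (x, y')).
  by apply: filterS => y' AG [x /AG].
apply: cA => x Ax.
have : nbhs (x, y) (~` G).
  by apply: open_nbhs_nbhs; split=> // Gxy; apply: yA; exists x.
by apply: filterS => -[].
Qed.

Lemma compact_image (g : X -> Y) (A : set X) :
  continuous g -> compact A -> compact (g @` A).
Proof. by move=> cg; apply: continuous_compact; exact: continuous_subspaceT. Qed.

Hypothesis hX : hausdorff_space X.
Hypothesis lX : locally_compact [set: X].

Lemma point_compact_nbhd (x : X) (O : set X) : nbhs x O ->
  exists N, [/\ compact N, nbhs x N & N `<=` O].
Proof.
move=> xO; have [V] := lX (I : setT x); rewrite withinET => xV [cV _].
have [|U xU UO] := @compact_regular _ x V hX cV xV (V `&` O); first exact: filterI.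
exists (closure U); split.
- apply: (subclosed_compact _ cV); first exact: closed_closure.
  by move=> z /UO[].
- by apply: filterS xU; exact: subset_closure.
- by move=> z /UO[].
Qed.

Lemma compact_nbhd (K O : set X) : compact K -> open O -> K `<=` O ->
  exists N, [/\ compact N, K `<=` N° & N `<=` O].
Proof.
move=> cK oO KO.
have [|||||N [cN NO] KN] := compact_directed (T := set X) cK
  (D := [set N | compact N /\ N `<=` O]) (le := subset) (P := fun N => N°).
- by move=> ? ? ?; exact: subset_trans.
- by exists set0; split=> //; exact: compact0.
- move=> N M [cN NO] [cM MO]; exists (N `|` M).
    by split; [exact: compactU|rewrite subUset].
  by rewrite -subUset.
- by move=> N M x NM; exact: interiorS.
- move=> x Kx; have [|N [cN xN NO]] := @point_compact_nbhd x O.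
    by apply: open_nbhs_nbhs; split=> //; exact: KO.
  by exists N => //; exact: nbhs_interior.
- by exists N.
Qed.

End CompactTopology.

(** * Lower sets of a closed preorder *)

Section Preorder.
Variable X : topologicalType.
Implicit Types (G : set (X * X)) (A P O : set X).

Definition closed_preorder G :=
  [/\ closed G, forall x, G (x, x) & rel_trans G].

Definition lower G A := forall x y, G (x, y) -> A y -> A x.

Lemma closed_swap G : closed G -> closed (G^-1)%relation.
Proof.
rewrite (_ : (G^-1)%relation = (fun p => (p.2, p.1)) @^-1` G); last first.
  by apply/seteqP; split=> -[].
suff /continuous_closedP : continuous (fun p : X * X => (p.2, p.1)) by apply.
by move=> [x y]; apply: cvg_pair; [exact: cvg_snd|exact: cvg_fst].
Qed.

Lemma closed_preorderV G : closed_preorder G -> closed_preorder (G^-1)%relation.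
Proof.
move=> [cG rG tG]; split=> //; first exact: closed_swap.
by move=> x y z xy yz; exact: tG yz xy.
Qed.

Lemma lowerC G A : lower G A -> lower (G^-1)%relation (~` A).
Proof. by move=> lA x y xy nAy /(lA _ _ xy). Qed.

Hypothesis hX : hausdorff_space X.
Hypothesis lX : locally_compact [set: X].

(** A compact neighborhood [N] of [P] ∩ [K] inside [O] generates a lower set that is closed, because
    [N] is compact and [G] closed, and stays in [O], because [O] is lower. It is added to [P]. *)
Lemma enlarge_lower G K P O : closed_preorder G -> compact K ->
  closed P -> lower G P -> open O -> lower G O -> P `<=` O ->
  exists P', [/\ closed P', lower G P', P `<=` P', P' `<=` O & P `&` K `<=` P'°].
Proof.
move=> [cG rG tG] cK cP lP oO lO PO.
have [|x [] /PO//|N [cN KN NO]] := compact_nbhd hX lX _ oO (K := P `&` K).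
  by rewrite setIC; exact: compact_closedI.
pose dN := [set y | exists2 x, N x & G (y, x)].
have NdN : N `<=` dN by move=> x Nx; exists x.
exists (P `|` dN); split.
- apply: closedU => //; exact: (compact_rel_closed cN (closed_swap cG)).
- move=> x y xy [Py|[z Nz yz]]; first by left; exact: lP xy Py.
  by right; exists z => //; exact: tG xy yz.
- by left.
- by move=> x [/PO//|[y /NO Oy xy]]; exact: lO xy Oy.
- by move=> x /KN; apply: interiorS => y /NdN; right.
Qed.

Variable G : set (X * X).
Hypothesis pG : closed_preorder G.

Definition lower_pair P O :=
  [/\ closed P, lower G P, open O, lower G O & P `<=` O].

(** [P] is enlarged first; then the complement of [O] is enlarged for the opposite preorder, which
    shrinks [O]. *)
Lemma squeeze_lower K P O : compact K -> lower_pair P O ->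
  exists PO', [/\ lower_pair PO'.1 PO'.2, P `<=` PO'.1, PO'.2 `<=` O,
    P `&` K `<=` PO'.1° & (~` O) `&` K `<=` (~` PO'.2)°].
Proof.
move=> cK [cP lP oO lO PO].
have [P' [cP' lP' PP' P'O KP']] := enlarge_lower pG cK cP lP oO lO PO.
have [|||||Q [cQ lQ OQ QP' KQ]] := @enlarge_lower _ K (~` O) (~` P')
    (closed_preorderV pG) cK.
- exact: open_closedC.
- exact: lowerC.
- exact: closed_openC.
- exact: lowerC.
- exact: subsetC.
exists (P', ~` Q) => /=; split=> //.
- split=> //; first exact: closed_openC.
    by move=> x y xy nQy Qx; apply: nQy; exact: lQ _ Qx.
  by apply: subsetCr.
- exact: subsetCl.
- by rewrite setCK.
Qed.

Hypothesis sX : sigma_compact X.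

(** Repeated squeezing gives increasing closed sets and decreasing open sets. Each point lies in
    some [K i], hence the union of the former is open and the intersection of the latter is
    closed. *)
Lemma interpolate_lower P O : lower_pair P O ->
  exists UD, [/\ lower_pair P UD.1, lower_pair UD.2 O & UD.1 `<=` UD.2].
Proof.
move=> PO; have [K cK KX] := sX.
have /choice[g gP] : forall nPO : nat * (set X * set X), exists PO' : set X * set X,
    lower_pair nPO.2.1 nPO.2.2 -> [/\ lower_pair PO'.1 PO'.2,
    nPO.2.1 `<=` PO'.1, PO'.2 `<=` nPO.2.2,
    nPO.2.1 `&` \big[setU/set0]_(i < nPO.1) K i `<=` PO'.1° &
    (~` nPO.2.2) `&` \big[setU/set0]_(i < nPO.1) K i `<=` (~` PO'.2)°].
  (* To make the choice total, anything that is not a lower pair is sent to itself. *)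
  move=> [n [P' O']] /=; have [PO'|nPO'] := pselect (lower_pair P' O'); last first.
    by exists (P', O') => /nPO'.
  have cKn : compact (\big[setU/set0]_(i < n) K i) by exact: bigsetU_compact.
  by have [PO'' ?] := squeeze_lower cKn PO'; exists PO''.
(* Stage [n] treats the first [n] compact sets. *)
pose s := fix s n := if n is n.+1 then g (n, s n) else (P, O).
have sP n : lower_pair (s n).1 (s n).2.
  by elim: n => [//|n IH]; have [] := gP (n, s n) IH.
have sE n := gP (n, s n) (sP n).
have sle n m : (n <= m)%N -> (s n).1 `<=` (s m).1 /\ (s m).2 `<=` (s n).2.
  move=> /subnK<-; elim: (m - n)%N => [|k [IH1 IH2]]; first by rewrite add0n; split.
  rewrite addSn.
  have [_ h1 h2 _ _] := sE (k + n)%N.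
  by split; [exact: subset_trans h1|exact: subset_trans h2 _].
have s12 n m : (s n).1 `<=` (s m).2.
  have [h1 _] := sle _ _ (leq_maxl n m); have [_ h2] := sle _ _ (leq_maxr n m).
  by have [_ _ _ _ h] := sP (maxn n m); move=> x /h1/h/h2.
have Kx x : exists i, K i x by have : setT x by []; rewrite -KX => -[i]; exists i.
have big_K n x i : K i x -> (i < n)%N -> (\big[setU/set0]_(i < n) K i) x.
  by move=> Kix ltin; rewrite -bigcup_mkord; exists i.
have openU : open (\bigcup_n (s n).1).
  rewrite openE => x [n _ sx]; have [i Kix] := Kx x.
  (* At this stage [x] already belongs to the closed set, and [K i] is among the compact sets
     treated. *)
  have [_ _ _ h _] := sE (maxn n i.+1).
  have /h : ((s (maxn n i.+1)).1 `&` \big[setU/set0]_(i < maxn n i.+1) K i) x.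
    split; first exact: (sle _ _ (leq_maxl _ _)).1.
    by apply: big_K Kix _; exact: leq_maxr.
  by apply: filterS => y sy; exists (maxn n i.+1).+1.
have closedD : closed (\bigcap_n (s n).2).
  rewrite -openC setC_bigcap openE => x [n _ sx]; have [i Kix] := Kx x.
  have [_ _ _ _ h] := sE (maxn n i.+1).
  have /h : (~` (s (maxn n i.+1)).2 `&` \big[setU/set0]_(i < maxn n i.+1) K i) x.
    split; first by apply: subsetC sx; exact: (sle _ _ (leq_maxl _ _)).2.
    by apply: big_K Kix _; exact: leq_maxr.
  by apply: filterS => y sy; exists (maxn n i.+1).+1.
exists (\bigcup_n (s n).1, \bigcap_n (s n).2) => /=; split.
- case: PO => cP lP _ _ _; split=> //; last by move=> x Px; exists 0%N.
  by move=> x y xy [n _ sy]; exists n => //; have [_ h _ _ _] := sP n; exact: h sy.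
- case: PO => _ _ oO lO _; split=> //; last by move=> x /(_ 0%N I).
  by move=> x y xy sy n _; have [_ _ _ h _] := sP n; exact: h (sy n I).
- by move=> x [n _ sx] m _; exact: s12 sx.
Qed.

End Preorder.

(** * Urysohn functions from interpolation *)

Lemma half_expr_small (R : realType) (e : R) : 0 < e -> exists n, 2^-1 ^+ n <= e.
Proof.
move=> e0; have : `|2^-1 : R| < 1 by rewrite ger0_norm// invf_lt1// ltr1n.
move=> /cvg_expr/cvgrPdist_le/(_ _ e0)[n _ /(_ n (leqnn n))].
by rewrite /= sub0r normrN ger0_norm ?exprn_ge0// => ?; exists n.
Qed.

Section Urysohn.
Variables (R : realType) (X : topologicalType).
Variable Q : set X -> set X -> Prop.
Hypothesis QP : forall D U, Q D U -> [/\ closed D, open U & D `<=` U].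
Variable m : set X * set X -> set X * set X.
Hypothesis mP : forall D U, Q D U ->
  [/\ Q D (m (D, U)).1, Q (m (D, U)).2 U & (m (D, U)).1 `<=` (m (D, U)).2].

(** Step function of level [n] in Urysohn's construction: each of the two pairs obtained by
    interpolating between [D] and [U] accounts for half of the range [0, 1]. *)
Fixpoint dyadic n (D U : set X) (x : X) : R :=
  if n is n.+1 then
    (dyadic n D (m (D, U)).1 x + dyadic n (m (D, U)).2 U x) / 2
  else (`[< ~ U x >])%:R.

Lemma dyadic_bound n D U x : 0 <= dyadic n D U x <= 1.
Proof.
elim: n D U => [|n IH] D U /=; first by rewrite ler0n lern1 leq_b1.
have := IH D (m (D, U)).1; have := IH (m (D, U)).2 U.
by move=> /andP[? ?] /andP[? ?]; apply/andP; split; lra.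
Qed.

Lemma dyadic0 n D U x : Q D U -> D x -> dyadic n D U x = 0.
Proof.
elim: n D U => [|n IH] D U DU Dx /=.
  by have [_ _ /(_ _ Dx) Ux] := QP DU; rewrite asboolF//; apply.
have [Q1 Q2 Q12] := mP DU.
have [_ _ /(_ _ Dx)/Q12 D'x] := QP Q1.
by rewrite !IH// addr0 mul0r.
Qed.

Lemma dyadic1 n D U x : Q D U -> ~ U x -> dyadic n D U x = 1.
Proof.
elim: n D U => [|n IH] D U DU Ux /=; first by rewrite asboolT.
have [Q1 Q2 Q12] := mP DU; rewrite !IH//; first lra.
by move=> /Q12; have [_ _ h] := QP Q2 => /h.
Qed.

(* One of the two terms averaged in [dyadic n.+1] is constant, so that errors
   are halved at each step. *)
Lemma dyadic_cases D U x : Q D U ->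
  (forall n, dyadic n (m (D, U)).2 U x = 0) \/
  (forall n, dyadic n D (m (D, U)).1 x = 1).
Proof.
move=> DU; have [Q1 Q2 Q12] := mP DU.
have [/Q12 Dx|Ux] := pselect ((m (D, U)).1 x).
  by left=> n; exact: dyadic0.
by right=> n; exact: dyadic1.
Qed.

Lemma dyadic_nondecreasing D U x : Q D U ->
  {homo (fun n => dyadic n D U x) : n k / (n <= k)%N >-> n <= k}.
Proof.
move=> DU; apply: homo_leq => [//||n]; [exact: le_trans|].
elim: n D U DU => [|n IH] D U DU.
  have [Ux|Ux] := pselect (U x); last by rewrite !dyadic1.
  by have /andP[? _] := dyadic_bound 1 D U x; rewrite [leLHS]/= asboolF//; apply.
by have [Q1 Q2 _] := mP DU; have := IH _ _ Q1; have := IH _ _ Q2 => /=; lra.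
Qed.

Lemma dyadic_cauchy n k D U x : Q D U ->
  dyadic k D U x <= dyadic n D U x + 2^-1 ^+ n.
Proof.
have e0 l : 0 < 2^-1 ^+ l :> R by rewrite exprn_gt0// invr_gt0.
elim: n k D U => [|n IH] k D U DU.
  rewrite expr0; have /andP[_ ?] := dyadic_bound k D U x.
  by have /andP[? _] := dyadic_bound 0 D U x; lra.
case: k => [|k].
  apply: (le_trans (dyadic_nondecreasing x DU (leq0n n.+1))).
  by rewrite lerDl ltW.
have [Q1 Q2 _] := mP DU; have := IH k _ _ Q1; have := IH k _ _ Q2.
have := e0 n; rewrite exprS /=.
by have [h|h] := dyadic_cases x DU; have h1 := h n; have h2 := h k; lra.
Qed.

(** On the open set [(m (D, U)).1] the second term vanishes; off it the first term already has its
    maximal value 1 at [x]. Either way only one of the averaged terms can rise near [x]. *)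
Lemma dyadic_usc n D U x : Q D U ->
  \forall y \near x, dyadic n D U y <= dyadic n D U x + 2^-1 ^+ n.
Proof.
elim: n D U => [|n IH] D U DU.
  near=> y; rewrite expr0; have /andP[_ ?] := dyadic_bound 0 D U y.
  by have /andP[? _] := dyadic_bound 0 D U x; lra.
have [Q1 Q2 Q12] := mP DU; rewrite exprS /=.
have [Ux|Ux] := pselect ((m (D, U)).1 x).
  have oU : nbhs x (m (D, U)).1 by have [_ oU _] := QP Q1; exact: open_nbhs_nbhs.
  near=> y.
  have y1 : dyadic n D (m (D, U)).1 y <= dyadic n D (m (D, U)).1 x + 2^-1 ^+ n.
    by near: y; exact: IH.
  have y2 : dyadic n (m (D, U)).2 U y = 0.
    by apply: dyadic0 => //; apply: Q12; near: y.
  have /andP[? _] := dyadic_bound n (m (D, U)).2 U x; lra.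
near=> y.
have y2 : dyadic n (m (D, U)).2 U y <= dyadic n (m (D, U)).2 U x + 2^-1 ^+ n.
  by near: y; exact: IH.
rewrite (dyadic1 _ Q1 Ux).
by have /andP[_ ?] := dyadic_bound n D (m (D, U)).1 y; lra.
Unshelve. all: by end_near. Qed.

(** Dual argument with the closed set [(m (D, U)).2]: on it the second term is already minimal, and
    on its open complement the first term is 1. *)
Lemma dyadic_lsc n D U x : Q D U ->
  \forall y \near x, dyadic n D U x <= dyadic n D U y + 2^-1 ^+ n.
Proof.
elim: n D U => [|n IH] D U DU.
  near=> y; rewrite expr0; have /andP[? _] := dyadic_bound 0 D U y.
  by have /andP[_ ?] := dyadic_bound 0 D U x; lra.
have [Q1 Q2 Q12] := mP DU; rewrite exprS /=.
have [Dx|Dx] := pselect ((m (D, U)).2 x).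
  near=> y.
  have y1 : dyadic n D (m (D, U)).1 x <= dyadic n D (m (D, U)).1 y + 2^-1 ^+ n.
    by near: y; exact: IH.
  rewrite (dyadic0 _ Q2 Dx).
  by have /andP[? _] := dyadic_bound n (m (D, U)).2 U y; lra.
have oD : nbhs x (~` (m (D, U)).2).
  by have [cD _ _] := QP Q2; apply: open_nbhs_nbhs; split=> //; exact: closed_openC.
near=> y.
have y2 : dyadic n (m (D, U)).2 U x <= dyadic n (m (D, U)).2 U y + 2^-1 ^+ n.
  by near: y; exact: IH.
have y1 : dyadic n D (m (D, U)).1 y = 1.
  by apply: dyadic1 => // /Q12; near: y.
have /andP[_ ?] := dyadic_bound n D (m (D, U)).1 x; lra.
Unshelve. all: by end_near. Qed.

Lemma dyadic_monotone n D U x y :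
  (forall D U, Q D U -> U y -> U x) ->
  Q D U -> dyadic n D U x <= dyadic n D U y.
Proof.
move=> yx; elim: n D U => [|n IH] D U DU /=.
  have [/(yx _ _ DU) Ux|Uy] := pselect (U y).
    by rewrite asboolF ?ler0n//; apply.
  by rewrite (asboolT Uy) lern1 leq_b1.
by have [Q1 Q2 _] := mP DU; have := IH _ _ Q1; have := IH _ _ Q2; lra.
Qed.

(** The step functions increase to [u] and stay within [2^-1 ^+ n] of it, while their oscillation
    near a point is at most [2^-1 ^+ n] in each direction. This gives continuity. The last clause is
    what makes [u] monotone when all sets involved are lower. *)
Lemma urysohn_function D U : Q D U ->
  exists u : X -> R, [/\ continuous u, forall x, 0 <= u x <= 1,
    forall x, D x -> u x = 0, forall x, ~ U x -> u x = 1 &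
    forall x y, (forall D U, Q D U -> U y -> U x) -> u x <= u y].
Proof.
move=> DU; pose w n x := dyadic n D U x; pose u x := sup (range (w ^~ x)).
have ubw x : ubound (range (w ^~ x)) 1.
  by move=> _ [n _ <-]; have /andP[] := dyadic_bound n D U x.
have wu n x : w n x <= u x.
  by apply: ub_le_sup; [exists 1; exact: ubw|exists n].
have uw n x : u x <= w n x + 2^-1 ^+ n.
  apply: ge_sup; first by exists (w 0 x), 0%N.
  by move=> _ [k _ <-]; exact: dyadic_cauchy.
exists u; split.
- move=> x; apply/cvgrPdist_le => /= e e0.
  (* Two errors of size [2^-1 ^+ n] add up: replacing [u] by [w n], and moving from [x] to [y]. *)
  have [n ne] : exists n, 2^-1 ^+ n <= e / 2 :> R.
    by apply: half_expr_small; rewrite divr_gt0.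
  near=> y.
  have h1 : w n y <= w n x + 2^-1 ^+ n by near: y; exact: dyadic_usc.
  have h2 : w n x <= w n y + 2^-1 ^+ n by near: y; exact: dyadic_lsc.
  have := wu n x; have := wu n y; have := uw n x; have := uw n y.
  by rewrite ler_norml => *; apply/andP; split; lra.
- move=> x; have /andP[h _] := dyadic_bound 0 D U x.
  rewrite (le_trans h (wu 0%N x)) /=.
  by apply: ge_sup; [exists (w 0 x), 0%N|exact: ubw].
- move=> x Dx; have := wu 0%N x.
  have : u x <= 0.
    apply: ge_sup; first by exists (w 0 x), 0%N.
    by move=> _ [n _ <-]; rewrite /w dyadic0.
  by rewrite /w dyadic0// => *; apply/le_anti/andP.
- move=> x Ux; have := wu 0%N x.
  have : u x <= 1 by apply: ge_sup; [exists (w 0 x), 0%N|exact: ubw].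
  by rewrite /w dyadic1// => *; apply/le_anti/andP.
- move=> x y yx; apply: ge_sup; first by exists (w 0 x), 0%N.
  move=> _ [n _ <-]; apply: le_trans (wu n y); exact: dyadic_monotone.
Unshelve. all: by end_near. Qed.

End Urysohn.

(** * Sufficiency of the Lyapunov functions *)

Section Grel.
Variable X : topologicalType.
Implicit Types f g : set (X * X).

Lemma Grel_min f g : closed g -> rel_trans g -> f `<=` g -> Grel f `<=` g.
Proof. by move=> cg tg; exact: smallest_sub. Qed.

Lemma closed_Grel f : closed (Grel f).
Proof. by apply: closed_bigI => g [[cg _] _]. Qed.

Lemma Grel_trans f : rel_trans (Grel f).
Proof.
move=> x y z xy yz g gf; have [[_ tg] _] := gf.
by apply: tg; [exact: xy|exact: yz].
Qed.

Lemma closed_diagonal : hausdorff_space X -> closed (@diagonal X).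
Proof.
move=> hX [x y] xy; apply: hX => A B xA yB.
have [|[z1 z2] [/= /diagonalP -> [zA zB]]] := xy (A `*` B); first by exists (A, B).
by exists z2.
Qed.

Lemma closed_preorder_Grel f : hausdorff_space X ->
  closed_preorder (diagonal `|` Grel f).
Proof.
move=> hX; split; last 2 first.
- by move=> x; left.
- move=> x y z [/diagonalP -> //|xy] [/diagonalP <-|yz]; right=> //.
  exact: Grel_trans xy yz.
- by apply: closedU; [exact: closed_diagonal|exact: closed_Grel].
Qed.

Lemma closed_preorder_diagonal : hausdorff_space X -> closed_preorder (@diagonal X).
Proof.
move=> hX; split=> //; first exact: closed_diagonal.
by move=> x y z /diagonalP -> /diagonalP ->; exact/diagonalP.
Qed.

End Grel.

Lemma closed_xsection (X Y : topologicalType) (G : set (X * Y)) x :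
  closed G -> closed (xsection G x).
Proof.
move=> cG; rewrite (_ : xsection G x = (fun y => (x, y)) @^-1` G); last first.
  by apply/seteqP; split=> y /xsectionP.
suff /continuous_closedP : continuous (fun y : Y => (x, y)) by apply.
by move=> y; apply: cvg_pair; [exact: cvg_cst|exact: cvg_id].
Qed.

Lemma bounded_fun_normP (R : realType) (X : Type) (u : X -> R) :
  bounded_fun u <-> exists M, forall x, `|u x| <= M.
Proof.
split=> [[M [_ h]]|[M h]].
  (* [bounded_fun] provides only bounds strictly above [M]. *)
  by exists (M + 1) => x; apply: (h (M + 1)) => //; rewrite ltrDl.
by exists M; split=> [|N MN x _]; [exact: num_real|exact: le_trans (ltW MN)].
Qed.

Lemma closed_le_rel (R : realType) (X : topologicalType) (L : X -> R) :
  continuous L -> closed (le_rel L).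
Proof.
move=> cL.
rewrite (_ : le_rel L = (fun p => L p.2 - L p.1) @^-1` [set x | 0 <= x]); last first.
  by apply/seteqP; split=> p; rewrite /le_rel /= subr_ge0.
suff /continuous_closedP : continuous (fun p : X * X => L p.2 - L p.1).
  by apply; exact: closed_ge.
move=> p; apply: cvgB.
- by apply: (cvg_comp snd L); [exact: cvg_snd|exact: cL].
- by apply: (cvg_comp fst L); [exact: cvg_fst|exact: cL].
Qed.

Lemma le_rel_Grel (R : realType) (X : topologicalType) (L : X -> R)
    (f : set (X * X)) :
  continuous L -> f `<=` le_rel L -> Grel f `<=` le_rel L.
Proof.
by move=> cL; apply: Grel_min; [exact: closed_le_rel|move=> a b c; exact: le_trans].
Qed.

(** * Order-preserving Urysohn functions, bumps, and sufficiency *)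

Section OrderedUrysohn.
Variables (R : realType) (X : topologicalType).
Hypothesis hX : hausdorff_space X.
Hypothesis lX : locally_compact [set: X].
Hypothesis sX : sigma_compact X.

Lemma ordered_urysohn (G : set (X * X)) (P O : set X) :
  closed_preorder G -> lower_pair G P O ->
  exists u : X -> R, [/\ continuous u, forall x, 0 <= u x <= 1,
    forall x, P x -> u x = 0, forall x, ~ O x -> u x = 1 &
    forall x y, G (x, y) -> u x <= u y].
Proof.
move=> pG PO; have /choice[m mP] : forall PO : set X * set X, exists UD : set X * set X,
    lower_pair G PO.1 PO.2 ->
    [/\ lower_pair G PO.1 UD.1, lower_pair G UD.2 PO.2 & UD.1 `<=` UD.2].
  move=> [P' O']; have [/= PO'|nPO'] := pselect (lower_pair G P' O').
    by have [UD ?] := interpolate_lower hX lX pG sX PO'; exists UD.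
  by exists (P', O') => /nPO'.
have [||u [cu u01 u0 u1 umono]] := @urysohn_function R X (lower_pair G) _ m _ P O PO.
- by move=> D U [].
- by move=> D U DU; exact: (mP (D, U) DU).
exists u; split=> // x y xy; apply: umono => D U [_ _ _ lU _].
exact: lU xy.
Qed.

(** For equality as the preorder every set is lower, and the classical statement results. *)
Lemma urysohn_set (P O : set X) : closed P -> open O -> P `<=` O ->
  exists u : X -> R, [/\ continuous u, forall x, 0 <= u x <= 1,
    forall x, P x -> u x = 0 & forall x, ~ O x -> u x = 1].
Proof.
move=> cP oO PO; have [|u [cu u01 u0 u1 _]] :=
    ordered_urysohn (closed_preorder_diagonal hX) (P := P) (O := O).
  by split=> // x y /diagonalP ->.
by exists u.
Qed.

Lemma compact_bump (x : X) (O : set X) : nbhs x O ->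
  exists c : X -> R, [/\ compactly_supported c, c x = 1 &
    forall y, ~ O y -> c y = 0].
Proof.
move=> xO; have [N [cN xN NO]] := point_compact_nbhd hX lX xO.
have [|||u [cu u01 u0 u1]] := @urysohn_set [set x] N°.
- exact/accessible_closed_set1/hausdorff_accessible.
- exact: open_interior.
- by move=> _ ->; exact: nbhs_singleton (nbhs_interior xN).
have uN y : ~ N y -> 1 - u y = 0.
  by move=> Ny; rewrite u1 ?subrr// => /interior_subset.
exists (fun y => 1 - u y); split.
- split; first by move=> y; apply: cvgB; [exact: cvg_cst|exact: cu].
  apply: (subclosed_compact _ cN); first exact: closed_closure.
  rewrite [X in _ `<=` X](closure_id N).1; last exact: compact_closed.
  apply: closureS => y /eqP yn; apply: contrapT => Ny; apply: yn; exact: uN.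
- by rewrite u0// subr0.
- by move=> y Oy; apply: uN => /NO.
Qed.

Lemma lyapunov_sufficient (f : set (X * X)) : sufficient f (@lyapunov R X f).
Proof.
split=> //; apply/seteqP; split=> [[x y] xy L [[cL bL] fL]|[x y] xy].
  case: xy => [/diagonalP -> //|]; rewrite /le_rel /=; first exact: lexx.
  by have := @le_rel_Grel _ _ L f cL; apply=> // -[a b]/fL.
apply: contrapT => nxy; pose G := diagonal `|` Grel f.
have pG : closed_preorder G by exact: closed_preorder_Grel.
have [cG rG tG] := pG.
(* The points below [y] form a closed lower set and the points not above [x] an open lower set;
   nesting holds since [x] is not below [y]. The resulting [u] is 0 at [y] and 1 at [x]. *)
have [|u [cu u01 u0 u1 umono]] :=
    ordered_urysohn pG (P := xsection (G^-1)%relation y) (O := ~` xsection G x).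
  split.
  - by apply: closed_xsection; exact: closed_swap.
  - by move=> a b ab /xsectionP yb; apply/xsectionP; exact: tG ab yb.
  - by apply: closed_openC; exact: closed_xsection.
  - by move=> a b ab xb /xsectionP xa; apply: xb; apply/xsectionP; exact: tG xa ab.
  - by move=> a /xsectionP ay /xsectionP xa; apply: nxy; exact: tG xa ay.
have uy : u y = 0 by apply: u0; apply/xsectionP; exact: rG.
have ux : u x = 1 by apply: u1; apply; apply/xsectionP; exact: rG.
suff /xy : lyapunov f u by rewrite /le_rel /= uy ux ler10.
split; last by move=> a b ab; apply: umono; right; exact: sub_gen_smallest.
split=> //; apply/bounded_fun_normP; exists 1 => a; have /andP[? ?] := u01 a.
by rewrite ger0_norm.
Qed.

End OrderedUrysohn.

(** * The Stone-Weierstrass theorem *)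

Section StoneWeierstrass.
Variables (R : realType) (Y : topologicalType).
Hypothesis cY : compact [set: Y].
Variable B : set (Y -> R).
Hypothesis B_cont : forall v, B v -> continuous v.
Hypothesis B_cst : forall c : R, B (cst c).
Hypothesis B_scale : forall (c : R) v, B v -> B (fun y => c * v y).
Hypothesis B_add : forall v w, B v -> B w -> B (v \+ w).
Hypothesis B_mul : forall v w, B v -> B w -> B (v \* w).
Hypothesis B_closed : forall v, continuous v ->
  (forall e : R, 0 < e -> exists2 w, B w & forall y, `|v y - w y| <= e) -> B v.
Hypothesis B_sep : forall x y, x <> y -> exists2 v, B v & v x <> v y.

Let B_eq v w : B v -> v =1 w -> B w.
Proof. by move=> Bv /funext <-. Qed.

(* Iterates converging from below to [|t|] for [|t| <= 1]. *)
Fixpoint abs_iter n (t : R) : R :=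
  if n is n.+1 then abs_iter n t + (t ^+ 2 - abs_iter n t ^+ 2) / 2 else 0.

(** One iteration multiplies the error [t - p] by [1 - (t + p) / 2], which lies between 0 and
    [1 - t / 2]. *)
Lemma abs_iter_bound n (t : R) : 0 <= t <= 1 ->
  0 <= abs_iter n t <= t /\ t - abs_iter n t <= t * (1 - t / 2) ^+ n.
Proof.
move=> /andP[t0 t1]; elim: n => [|n [/andP[p0 pt] IH]] /=.
  by rewrite lexx t0 expr0; split=> //; lra.
set p := abs_iter n t in p0 pt IH *.
have q0 : 0 <= 1 - t / 2 by lra.
have E : t - (p + (t ^+ 2 - p ^+ 2) / 2) = (t - p) * (1 - (t + p) / 2).
  by rewrite !expr2; lra.
split.
  have h1 : 0 <= t - (p + (t ^+ 2 - p ^+ 2) / 2).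
    by rewrite E mulr_ge0; lra.
  have h2 : 0 <= t ^+ 2 - p ^+ 2 by rewrite subr_ge0 lerXn2r.
  by apply/andP; split; lra.
by rewrite E exprSr mulrA; apply: ler_pM => //; lra.
Qed.

Lemma abs_iter_norm n (t : R) : abs_iter n `|t| = abs_iter n t.
Proof. by elim: n => [//|n /= ->]; rewrite real_normK ?num_real. Qed.

Lemma abs_iter_cvg (e : R) : 0 < e ->
  exists n, forall t, `|t| <= 1 -> `| `|t| - abs_iter n t| <= e.
Proof.
move=> e0; wlog e1 : e e0 / e <= 1.
  move=> wh; have [||n nP] := wh (Num.min e 1).
  - by rewrite lt_min e0 ltr01.
  - by rewrite ge_min lexx orbT.
  by exists n => t t1; apply: (le_trans (nP t t1)); rewrite ge_min lexx.
have q1 : `|1 - e / 2| < 1 by rewrite ger0_norm; lra.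
have /cvgrPdist_le/(_ _ e0)[n _ /(_ n (leqnn n))] := cvg_expr q1.
rewrite /= sub0r normrN ger0_norm ?exprn_ge0//; last lra.
move=> qe; exists n => t t1; rewrite -abs_iter_norm.
have [|/andP[h0 h1] h2] := @abs_iter_bound n `|t|; first by rewrite normr_ge0.
rewrite ger0_norm; last lra.
(* For small [t] the error is at most [t] itself; otherwise the geometric factor is at most
   [(1 - e / 2) ^+ n]. *)
have [te|et] := leP `|t| e; first lra.
apply: (le_trans h2); apply: le_trans qe.
rewrite -[leRHS]mul1r; apply: ler_pM => //; first by rewrite exprn_ge0//; lra.
by rewrite lerXn2r ?nnegrE; lra.
Qed.

Lemma B_abs v : B v -> B (fun y => `|v y|).
Proof.
move=> Bv; have [M Mv] : exists M, forall y, `|v y| <= M.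
  have /compact_bounded[M [_ h]] : compact (range v).
    exact: compact_image (B_cont Bv) cY.
  exists (M + 1) => y; apply: (h (M + 1)); first by rewrite ltrDl.
  by exists y.
(* A positive bound even if [Y] is empty and [M] negative; dividing by it brings [v] into
   [-1, 1]. *)
pose N := M + 1 + `|M|.
have N0 : 0 < N by have := ler_norm (- M); rewrite /N normrN; lra.
have MN : M <= N by have := normr_ge0 M; rewrite /N; lra.
pose w y := N^-1 * v y.
have Bw : B w by exact: B_scale.
have w1 y : `|w y| <= 1.
  rewrite normrM ger0_norm ?invr_ge0 ?(ltW N0)// mulrC ler_pdivrMr// mul1r.
  exact: le_trans MN.
have Biter n : B (abs_iter n \o w).
  elim: n => [|n IH]; first exact: (B_cst 0).
  apply: (B_eq (v := (abs_iter n \o w) \+ (fun y => 2^-1 *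
     ((w \* w) \+ (fun y => -1 * ((abs_iter n \o w) \* (abs_iter n \o w)) y)) y))).
    by apply: B_add => //; apply: B_scale; apply: B_add; [exact: B_mul|
       apply: B_scale; exact: B_mul].
  by move=> y /=; rewrite mulrC !expr2 mulN1r.
suff : B (fun y => `|w y|).
  move=> /(B_scale N) Bnw; apply: (B_eq Bnw) => y.
  by rewrite normrM ger0_norm ?invr_ge0 ?(ltW N0)// mulrA divff ?mul1r// gt_eqF.
apply: B_closed => [y|e e0]; first by apply: cvg_norm; exact: B_cont.
have [n nP] := abs_iter_cvg e0; exists (abs_iter n \o w) => // y.
exact: nP.
Qed.

Lemma B_sub v w : B v -> B w -> B (fun y => v y - w y).
Proof.
move=> Bv Bw; apply: (B_eq (B_add Bv (B_scale (-1) Bw))) => y /=.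
by rewrite mulN1r.
Qed.

Lemma B_max v w : B v -> B w -> B (fun y => Num.max (v y) (w y)).
Proof.
move=> Bv Bw; have /(B_scale 2^-1) := B_add (B_add Bv Bw) (B_abs (B_sub Bv Bw)).
move=> h; apply: (B_eq h) => y /=; rewrite maxr_absE; lra.
Qed.

Lemma B_min v w : B v -> B w -> B (fun y => Num.min (v y) (w y)).
Proof.
move=> Bv Bw; have /(B_scale 2^-1) := B_sub (B_add Bv Bw) (B_abs (B_sub Bv Bw)).
move=> h; apply: (B_eq h) => y /=; rewrite minr_absE; lra.
Qed.

Lemma B_interpolate (a b : R) x y : x <> y -> exists w, [/\ B w, w x = a & w y = b].
Proof.
move=> xy; have [h Bh hxy] := B_sep xy.
have d0 : h y - h x != 0 by rewrite subr_eq0; apply/eqP => /esym.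
have Bhx : B (fun z => h z - h x) := B_sub Bh (B_cst (h x)).
exists (cst a \+ (fun z => (b - a) / (h y - h x) * (h z - h x))); split=> /=.
- exact: B_add (B_cst a) (B_scale _ Bhx).
- by rewrite subrr mulr0 addr0.
- by rewrite divfK// addrC subrK.
Qed.

(** Lattice argument: maxima of two-point interpolants give, for each [x], a function above [v - e]
    everywhere and below [v + e] at [x]; minima of these over [x] are within [e] of [v]. *)
Theorem stone_weierstrass v : continuous v -> B v.
Proof.
move=> cv; apply: B_closed => // e e0.
have near_lt (g h : Y -> R) y : continuous g -> continuous h -> g y < h y ->
    \forall z \near y, g z < h z.
  move=> cg ch gh; have : 0 < h y - g y by rewrite subr_gt0.
  have : (fun z => h z - g z) @ y --> h y - g y by apply: cvgB; [exact: ch|exact: cg].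
  move=> /cvgr_gt h0 /h0; apply: filterS => z; by rewrite subr_gt0.
have cve (c : R) : continuous (fun y => v y + c).
  by move=> y; apply: cvgD; [exact: cv|exact: cvg_cst].
have above x : exists2 g, B g /\ g x < v x + e & forall y, v y - e < g y.
  have [|||||g Dg gP] := compact_directed (T := Y -> R) cY
    (D := [set g | B g /\ g x < v x + e]) (le := fun g h => forall y, g y <= h y)
    (P := fun g y => v y - e < g y).
  - by move=> a b c ab bc y; exact: le_trans (ab y) (bc y).
  - by exists (cst (v x)); split=> //=; rewrite ltrDl.
  - move=> a b [Ba ax] [Bb bx]; exists (fun y => Num.max (a y) (b y)).
      by split; [exact: B_max|rewrite gt_max ax].
    by split=> y; rewrite le_max lexx ?orbT.
  - by move=> a b y ab ay; exact: lt_le_trans (ab y).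
  - move=> y _; have [g [Bg gx gy]] : exists g, [/\ B g, g x = v x & g y = v y].
      have [->|/eqP xy] := eqVneq x y; first by exists (cst (v y)).
      exact: B_interpolate.
    exists g; first by split=> //; rewrite gx ltrDl.
    by apply: near_lt; [exact: cve|exact: B_cont|rewrite gy gtrDl oppr_lt0].
  - by exists g => // y; exact: gP.
(* A directed family has to be nonempty, so the empty space is treated apart. *)
have [y0|Y0] := pselect ([set: Y] !=set0); last first.
  by exists (cst 0) => // y; exfalso; apply: Y0; exists y.
(* The order is reversed, as the family is now directed by minima. *)
have [|||||g [Bg gv] gP] := compact_directed (T := Y -> R) cY
  (D := [set g | B g /\ forall y, v y - e < g y])
  (le := fun g h => forall y, h y <= g y)
  (P := fun g y => g y < v y + e).
- by move=> a b c ab bc y; exact: le_trans (bc y) (ab y).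
- by have [x _] := y0; have [g [Bg _] gP] := above x; exists g.
- move=> a b [Ba ax] [Bb bx]; exists (fun y => Num.min (a y) (b y)).
    by split; [exact: B_min|move=> y; rewrite lt_min ax bx].
  by split=> y; rewrite ge_min lexx ?orbT.
- by move=> a b y ab ay; exact: le_lt_trans (ab y) ay.
- move=> y _; have [g [Bg gy] gP] := above y; exists g => //.
  by apply: near_lt => //; exact: B_cont.
exists g => // y; have := gP y I; have := gv y.
by rewrite ler_norml => *; apply/andP; split; lra.
Qed.

End StoneWeierstrass.

(** * Proper compactifications *)

Lemma hausdorff_prod (X Y : topologicalType) :
  hausdorff_space X -> hausdorff_space Y -> hausdorff_space (X * Y)%type.
Proof.
move=> hX hY [x y] [x' y'] pq; congr (_, _).
- apply: hX => A B xA x'B.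
  have [||[z w] [[/= Az _] [/= Bz _]]] := pq (A `*` setT) (B `*` setT).
  + by exists (A, setT) => //; split=> //; exact: filterT.
  + by exists (B, setT) => //; split=> //; exact: filterT.
  + by exists z.
- apply: hY => A B yA y'B.
  have [||[z w] [[/= _ Aw] [/= _ Bw]]] := pq (setT `*` A) (setT `*` B).
  + by exists (setT, A) => //; split=> //; exact: filterT.
  + by exists (setT, B) => //; split=> //; exact: filterT.
  + by exists w.
Qed.

Section ProperCompactification.
Variables (X Y : topologicalType) (i : X -> Y).
Hypothesis hX : hausdorff_space X.
Hypothesis lX : locally_compact [set: X].
Hypothesis Yi : proper_compactification i.

Let cY : compact [set: Y]. Proof. by case: Yi. Qed.
Let hY : hausdorff_space Y. Proof. by case: Yi. Qed.

Lemma embedding_inj : injective i. Proof. by case: Yi => _ _ []. Qed.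

Lemma embedding_open (U : set X) : open U -> exists2 V, open V & i @^-1` V = U.
Proof. by case: Yi => _ _ [_ oE] _; rewrite oE => -[V]; exists V. Qed.

Lemma embedding_continuous : continuous i.
Proof.
by case: Yi => _ _ [_ oE] _; apply/continuousP => V oV; rewrite oE; exists V.
Qed.

(** Density principle by which closed conditions pass from [X] to all of [Y]. *)
Lemma dense_closed (C : set Y) : closed C -> (forall x, C (i x)) -> forall y, C y.
Proof.
move=> cC Ci y; apply: contrapT => Cy; case: Yi => _ _ _ /(_ (~` C)).
by case=> [||z [Cz [x _ xz]]]; [exists y|exact: closed_openC|apply: Cz; rewrite -xz].
Qed.

Lemma compact_embedding_closed (N : set X) : compact N -> closed (i @` N).
Proof.
by move=> cN; apply: compact_closed => //; exact: compact_image embedding_continuous cN.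
Qed.

(** [X] is open in [Y]: if the open set [V] has the interior of the compact set [N'] as its trace,
    then [V] minus the closed set [i(N')] is open and misses the dense set [X], hence is empty. *)
Lemma embedding_nbhs (x : X) (N : set X) : nbhs x N -> nbhs (i x) (i @` N).
Proof.
move=> xN; have [N' [cN' xN' N'N]] := point_compact_nbhd hX lX xN.
have [V oV VN'] := embedding_open (open_interior N').
have Vx : V (i x).
  by rewrite -[V (i x)]/((i @^-1` V) x) VN'; exact: nbhs_singleton (nbhs_interior xN').
apply: (@filterS _ _ _ V); last exact: open_nbhs_nbhs.
move=> y Vy; suff [x' N'x' <-] : (i @` N') y by exists x' => //; exact: N'N.
have : ~ (~` (i @` N') `&` V) y; last first.
  by move=> h; apply: contrapT => yN'; apply: h.
have : closed (~` V `|` (i @` N')).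
  by apply: closedU; [exact: open_closedC|exact: compact_embedding_closed].
move=> /dense_closed/(_ _ y)[z||]; last 2 first.
- by move=> nVy [].
- by move=> yN' [].
have [Vz|nVz] := pselect (V (i z)); last by left.
right; exists z => //; apply: interior_subset.
by rewrite -VN'.
Qed.

Lemma compact_embedding_preimage (C : set Y) :
  compact C -> C `<=` range i -> compact (i @^-1` C).
Proof.
move=> cC Ci F PF FC; have [y [Cy Fy]] := cC (i @ F) _ FC.
have [x _ xy] := Ci y Cy; subst y; exists x; split=> // A B FA xB.
have [||_ [[a Aa <-] [b Bb /embedding_inj ba]]] := Fy (i @` A) (i @` B).
- by apply: (@filterS _ F _ A) => // a Aa; exists a.
- exact: embedding_nbhs.
- by exists a; split=> //; rewrite -ba.
Qed.

Lemma closed_embedding_preimage (g : set (Y * Y)) :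
  closed g -> closed [set p | g (i p.1, i p.2)].
Proof.
move=> cg; suff /continuous_closedP : continuous (fun p : X * X => (i p.1, i p.2)).
  by apply.
move=> p; apply: cvg_pair.
- by apply: (cvg_comp fst i); [exact: cvg_fst|exact: embedding_continuous].
- by apply: (cvg_comp snd i); [exact: cvg_snd|exact: embedding_continuous].
Qed.

Variable f : set (X * X).

Lemma sub_hat_rel p : f p -> hat_rel i f (i p.1, i p.2).
Proof. by move=> fp; apply: subset_closure; exists p. Qed.

Lemma hat_rel_min (g : set (Y * Y)) : closed g ->
  (forall x y, f (x, y) -> g (i x, i y)) -> hat_rel i f `<=` g.
Proof.
move=> cg fg; rewrite (closure_id g).1//; apply: closureS.
by move=> _ [[x y] fxy <-]; exact: fg.
Qed.

Lemma Grel_sub_hat p : Grel f p -> Grel (hat_rel i f) (i p.1, i p.2).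
Proof.
have : Grel f `<=` [set p | Grel (hat_rel i f) (i p.1, i p.2)]; last exact.
apply: Grel_min.
- by apply: closed_embedding_preimage; exact: closed_Grel.
- by move=> x y z; exact: Grel_trans.
- by move=> q fq; apply: sub_gen_smallest; exact: sub_hat_rel.
Qed.

(** Over a compact neighborhood [N] of [x], [f] is the compact set [f] ∩ ([N] × [f(N)]), whose image
    is closed in [Y] × [Y]. Pairs of [f] close to [(i x, y)] start in [N], so [(i x, y)] lies in
    that image. *)
Lemma hat_rel_plus_proper : plus_proper f -> forall x y,
  hat_rel i f (i x, y) -> exists2 y', f (x, y') & i y' = y.
Proof.
move=> [cf pf] x y xy; have [N [cN xN _]] := point_compact_nbhd hX lX (@filterT _ (nbhs x) _).
pose A := rel_image f N; pose ii (p : X * X) := (i p.1, i p.2).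
have cA : compact A by exact: pf.
have cK : compact ((N `*` A) `&` f) by apply: compact_closedI => //; exact: compact_setX.
have : closed (ii @` ((N `*` A) `&` f)).
  apply: compact_closed; first exact: hausdorff_prod.
  apply: compact_image cK => p; apply: cvg_pair.
  - by apply: (cvg_comp fst i); [exact: cvg_fst|exact: embedding_continuous].
  - by apply: (cvg_comp snd i); [exact: cvg_snd|exact: embedding_continuous].
move=> /(_ (i x, y))[].
  move=> W xyW.
  have : nbhs (i x, y) (W `&` (i @` N `*` setT)).
    apply: filterI => //; exists (i @` N, setT) => //=.
    by split; [exact: embedding_nbhs|exact: filterT].
  move=> /xy[_ [[[a b] fab <-] [Wab [[a' Na' /embedding_inj aa'] _]]]].
  subst a'; exists (i a, i b); split=> //; exists (a, b) => //; split=> //; split=> //.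
  by exists a => //; apply/xsectionP.
by move=> [a b] [_ fab] [/embedding_inj <- <-]; exists b.
Qed.

End ProperCompactification.

(** * Composition and first steps of closed relations on a compact space *)

Section FirstStep.
Variable Y : topologicalType.
Hypothesis cY : compact [set: Y].
Variable g : set (Y * Y).
Hypothesis cg : closed g.

(** The intermediate points range over a closed set [T], so that chains can later be required to
    pass through a given set. *)
Lemma closed_rel_comp (T : set Y) (h k : set (Y * Y)) : closed T ->
  closed h -> closed k ->
  closed [set p | exists2 z, T z & h (p.1, z) /\ k (z, p.2)].
Proof.
move=> cT ch ck; have {}cT : compact T by exact: subclosed_compact cY _.
have c1 : closed [set q : Y * (Y * Y) | h (q.2.1, q.1)].
  suff /continuous_closedP : continuous (fun q : Y * (Y * Y) => (q.2.1, q.1)).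
    by move=> /(_ _ ch).
  move=> q; apply: cvg_pair; last exact: cvg_fst.
  by apply: (cvg_comp snd fst); [exact: cvg_snd|exact: cvg_fst].
have c2 : closed [set q : Y * (Y * Y) | k (q.1, q.2.2)].
  suff /continuous_closedP : continuous (fun q : Y * (Y * Y) => (q.1, q.2.2)).
    by move=> /(_ _ ck).
  move=> q; apply: cvg_pair; first exact: cvg_fst.
  by apply: (cvg_comp snd snd); exact: cvg_snd.
exact: compact_rel_closed cT (closedI c1 c2).
Qed.

(** The union of [g] and of [g] followed by [Grel g] is closed, by compactness, and transitive, so
    it contains [Grel g]. *)
Lemma Grel_first_step a b : Grel g (a, b) ->
  g (a, b) \/ exists2 c, g (a, c) & Grel g (c, b).
Proof.
pose h := g `|` [set p | exists2 z, setT z & g (p.1, z) /\ Grel g (z, p.2)].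
have hG : h `<=` Grel g.
  move=> [x y] [gxy|[z _ [/= xz zy]]]; first exact: sub_gen_smallest.
  by apply: Grel_trans zy; exact: sub_gen_smallest.
have : Grel g `<=` h; last by move=> gh /gh[|[c _ []]]; [left|right; exists c].
apply: Grel_min => //.
- apply: closedU => //; apply: closed_rel_comp => //; exact: closed_Grel.
- move=> x y z [xy|[w _ [/= xw wy]]] /hG yz; right => /=.
    by exists y.
  by exists w => //; split => //; exact: Grel_trans wy yz.
- by move=> p gp; left.
Qed.

End FirstStep.

(** * Closed subalgebras *)

Section FunctionAlgebra.
Variables (R : realType) (X : topologicalType).
Implicit Types (A S : set (X -> R)) (u v : X -> R).

Lemma closed_uniformP A : closed (A : set {uniform X -> R}) <->
  forall u, (forall e : R, 0 < e -> exists2 v, A v & forall x, `|u x - v x| <= e) ->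
    A u.
Proof.
split=> [cA u uA|cA u uA].
  apply: cA => W /uniform_nbhs[E [entE EW]].
  move: entE; rewrite -entourage_ballE => -[e /= e0 eE].
  have [v Av uv] := uA (e / 2) (divr_gt0 e0 (ltr0Sn _ 1)).
  exists v; split=> //; apply: EW => x _; apply: eE => /=.
  by apply: le_lt_trans (uv x) _; rewrite ltr_pdivrMr// ltr_pMr// ltr1n.
apply: cA => e e0.
have [|v [Av uv]] := uA [set v | forall x, `|u x - v x| <= e].
  apply/uniform_nbhs; exists [set xy | ball xy.1 e xy.2]; split.
    exact: entourage_ball (PosNum e0).
  by move=> v uv x; exact/ltW/(uv x).
by exists v.
Qed.

(** Being one of the algebras intersected by [smallest], this one makes the members of a generated
    algebra bounded and continuous. *)
Lemma closed_subalgebra_bounded : closed_subalgebra (@bounded_continuous R X).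
Proof.
split=> //.
- move=> c; split; first exact: cst_continuous.
  by apply/bounded_fun_normP; exists `|c|.
- move=> c u [cu /bounded_fun_normP[M uM]]; split.
    by move=> x; apply: cvgM; [exact: cvg_cst|exact: cu].
  by apply/bounded_fun_normP; exists (`|c| * M) => x; rewrite normrM ler_wpM2l.
- move=> u v [cu /bounded_fun_normP[M uM]] [cv /bounded_fun_normP[N vN]]; split; split.
  + by move=> x; apply: cvgD; [exact: cu|exact: cv].
  + apply/bounded_fun_normP; exists (M + N) => x.
    by apply: le_trans (ler_normD _ _) _; exact: lerD.
  + by move=> x; apply: cvgM; [exact: cu|exact: cv].
  + by apply/bounded_fun_normP; exists (M * N) => x; rewrite normrM ler_pM.
- apply/closed_uniformP => u uA; split.
    move=> x; apply/cvgrPdist_le => /= e e0.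
    have [v [cv _] uv] := uA (e / 3) (divr_gt0 e0 (ltr0Sn _ 2)).
    have e3 : 0 < e / 3 by rewrite divr_gt0.
    have /cvgrPdist_le/(_ _ e3) := cv x; apply: filterS => y vxy.
    have := uv x; have := uv y; move: vxy; rewrite !ler_norml.
    by move=> /andP[? ?] /andP[? ?] /andP[? ?]; apply/andP; split; lra.
  have [v [_ /bounded_fun_normP[M vM]] uv] := uA 1 ltr01.
  apply/bounded_fun_normP; exists (M + 1) => x.
  rewrite -(subrK (v x) (u x)) addrC.
  by apply: le_trans (ler_normD _ _) _; exact: lerD.
Qed.

Lemma closed_subalgebra_smallest S : S `<=` @bounded_continuous R X ->
  closed_subalgebra (smallest (@closed_subalgebra R X) S).
Proof.
move=> Sb; split.
- by apply: smallest_sub => //; exact: closed_subalgebra_bounded.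
- by move=> c A [[_ h _ _ _] _].
- by move=> c u uS A AS; have [[_ _ h _ _] _] := AS; exact: h (uS A AS).
- move=> u v uS vS; split=> A AS; have [[_ _ _ h _] _] := AS.
    by have [] := h _ _ (uS A AS) (vS A AS).
  by have [] := h _ _ (uS A AS) (vS A AS).
- by apply: closed_bigI => A [[]].
Qed.

Lemma compactly_supported_bounded :
  @compactly_supported R X `<=` @bounded_continuous R X.
Proof.
move=> u [cu cK]; split=> //.
have /compact_bounded[M [_ h]] := compact_image cu cK.
(* The bound must exceed [M] on the support and be nonnegative where [u] vanishes. *)
apply/bounded_fun_normP; exists (M + 1 + `|M|) => x.
have [->|ux] := eqVneq (u x) 0.
  by rewrite normr0; have := ler_norm (- M); rewrite normrN; lra.
apply: (h (M + 1 + `|M|)); first by have := normr_ge0 M; lra.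
by exists x => //; exact: subset_closure.
Qed.

Lemma lyapunov_algebra_closed f LL : LL `<=` @lyapunov R X f ->
  closed_subalgebra (lyapunov_algebra LL).
Proof.
move=> LLf; apply: closed_subalgebra_smallest => u [/LLf[]//|].
exact: compactly_supported_bounded.
Qed.

End FunctionAlgebra.

(** * Lyapunov compactifications *)

Lemma compact_sigma_compact (Y : topologicalType) :
  compact [set: Y] -> sigma_compact Y.
Proof. by move=> cY; exists (fun=> setT) => //; rewrite bigcup_const//; exists 0%N. Qed.

Lemma compact_locally_compact (Y : topologicalType) :
  compact [set: Y] -> locally_compact [set: Y].
Proof.
move=> cY y _; rewrite withinET; exists setT; first exact: filterT.
by split=> //; exact: closedT.
Qed.

Section LyapunovCompactification.
Variables (R : realType) (X Y : topologicalType) (i : X -> Y).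
Hypothesis hX : hausdorff_space X.
Hypothesis lX : locally_compact [set: X].
Variables (f : set (X * X)) (LL : set (X -> R)).
Hypothesis LLf : LL `<=` lyapunov f.
Hypothesis YL : lyapunov_compactification i LL.

Let Yi : proper_compactification i. Proof. by case: YL. Qed.
Let cY : compact [set: Y]. Proof. by case: Yi. Qed.
Let hY : hausdorff_space Y. Proof. by case: Yi. Qed.

Lemma algebra_extends u : lyapunov_algebra LL u ->
  exists2 v : Y -> R, continuous v & forall x, v (i x) = u x.
Proof. by case: YL => _ <- []. Qed.

Lemma algebra_restrict (v : Y -> R) : continuous v -> lyapunov_algebra LL (v \o i).
Proof.
move=> cv; case: YL => _ <-; split; last by exists v.
split.
  by move=> x; apply: continuous_comp; [exact: embedding_continuous|exact: cv].
have /compact_bounded[M [_ h]] := compact_image cv cY.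
apply/bounded_fun_normP; exists (M + 1) => x.
by apply: (h (M + 1)); [rewrite ltrDl|exists (i x)].
Qed.

Lemma extension_unique (v w : Y -> R) : continuous v -> continuous w ->
  (forall x, v (i x) = w (i x)) -> v =1 w.
Proof.
move=> cv cw vw y; apply/eqP; rewrite -subr_eq0; apply/eqP.
have cvw : continuous (fun z => v z - w z).
  by move=> z; apply: cvgB; [exact: cv|exact: cw].
have : closed [set z | v z - w z = 0].
  by move/continuous_closedP: cvw => /(_ _ (@closed_eq R 0)).
by move=> /(dense_closed Yi) h; apply: (h _ y) => x /=; rewrite vw subrr.
Qed.

(** The zero set of [v] together with the image of the support, which is compact, is closed and
    contains [X]; so it contains [p], which is not in that image. *)
Lemma compactly_supported_extension0 (u : X -> R) (v : Y -> R) p :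
  compactly_supported u -> continuous v -> (forall x, v (i x) = u x) ->
  ~ range i p -> v p = 0.
Proof.
move=> [cu cK] cv vu pX.
have : closed ([set z | v z = 0] `|` i @` closure [set x | u x != 0]).
  apply: closedU; last exact: compact_embedding_closed cK.
  by move/continuous_closedP: cv => /(_ _ (@closed_eq R 0)).
move=> /(dense_closed Yi)/(_ _ p)[x||[x _ xp]] //; last first.
  by exfalso; apply: pX; exists x.
have [ux|ux] := eqVneq (u x) 0; first by left; rewrite /= vu.
by right; exists x => //; exact: subset_closure.
Qed.

(** The functions whose extensions agree at [p] and [q] form a closed subalgebra containing the
    generators: [LL] by assumption, compactly supported functions because their extensions vanish at
    both points. It is then the whole algebra, although some continuous function on [Y] would
    separate [p] from [q] if they were distinct. *)
Lemma separate_at_infinity p q : ~ range i p -> ~ range i q ->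
  (forall L (v : Y -> R), LL L -> continuous v -> (forall x, v (i x) = L x) ->
     v p = v q) -> p = q.
Proof.
move=> pX qX LLpq; have aA := lyapunov_algebra_closed LLf.
have [Ab Ac As Am /closed_uniformP Acl] := aA.
pose B := [set u | lyapunov_algebra LL u /\ exists v : Y -> R,
  [/\ continuous v, forall x, v (i x) = u x & v p = v q]].
have AB : lyapunov_algebra LL `<=` B.
  apply: smallest_sub; last first.
    move=> u uS; have Au : lyapunov_algebra LL u by exact: sub_gen_smallest.
    split=> //; have [v cv vu] := algebra_extends Au; exists v; split=> //.
    case: uS => [Lu|Cu]; first exact: LLpq Lu cv vu.
    by rewrite !(compactly_supported_extension0 Cu cv vu).
  split.
  - by move=> u [/Ab].
  - by move=> c; split=> //; exists (cst c); split=> //; exact: cst_continuous.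
  - move=> c u [/(As c) Acu [v [cv vu vpq]]]; split=> //.
    exists (fun y => c * v y); split=> [y|x|]; last by rewrite vpq.
    + by apply: cvgM; [exact: cvg_cst|exact: cv].
    + by rewrite vu.
  - move=> u1 u2 [A1 [v1 [cv1 vu1 vpq1]]] [A2 [v2 [cv2 vu2 vpq2]]].
    have [? ?] := Am _ _ A1 A2; split; split=> //.
    + exists (v1 \+ v2); split=> [y|x|]; last by rewrite /= vpq1 vpq2.
        by apply: cvgD; [exact: cv1|exact: cv2].
      by rewrite /= vu1 vu2.
    + exists (v1 \* v2); split=> [y|x|]; last by rewrite /= vpq1 vpq2.
        by apply: cvgM; [exact: cv1|exact: cv2].
      by rewrite /= vu1 vu2.
  - apply/closed_uniformP => u uB.
    have Au : lyapunov_algebra LL u.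
      by apply: Acl => e /uB[v [Av _] uv]; exists v.
    split=> //; have [v cv vu] := algebra_extends Au; exists v; split=> //.
    apply/eqP; rewrite -subr_eq0 -normr_le0; apply/ler_addgt0Pr => e e0.
    have e2 : 0 < e / 2 by rewrite divr_gt0.
    have [w [Aw [w' [cw' w'w wpq]]] uw] := uB _ e2.
    (* The uniform estimate on [X] extends to [Y] by density. *)
    have vw' y : `|v y - w' y| <= e / 2.
      have : closed [set y | `|v y - w' y| <= e / 2].
        have : continuous (fun y => `|v y - w' y|).
          by move=> z; apply: cvg_norm; apply: cvgB; [exact: cv|exact: cw'].
        by move=> /continuous_closedP/(_ _ (@closed_le R (e / 2))).
      by move=> /(dense_closed Yi) h; apply: (h _ y) => x /=; rewrite vu w'w.
    have := vw' p; have := vw' q; rewrite wpq !ler_norml add0r.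
    by move=> /andP[? ?] /andP[? ?]; apply/andP; split; lra.
apply: contrapT => pq.
have [|||w [cw _ w0 w1]] := @urysohn_set R Y hY (compact_locally_compact cY)
    (compact_sigma_compact cY) [set p] (~` [set q]).
- exact/accessible_closed_set1/hausdorff_accessible.
- exact/closed_openC/accessible_closed_set1/hausdorff_accessible.
- by move=> _ -> /=.
have [_ [v [cv vw vpq]]] := AB _ (algebra_restrict cw).
have vE : v =1 w by exact: extension_unique.
have : w p = w q by rewrite -!vE.
have -> : w q = 1 by apply: w1; apply.
by rewrite w0// => /eqP; rewrite eq_sym oner_eq0.
Qed.

Hypothesis LLs : sufficient f LL.
Hypothesis pf : plus_proper f.

Lemma hat_Grel_lyapunov L (v : Y -> R) : LL L -> continuous v ->
  (forall x, v (i x) = L x) -> Grel (hat_rel i f) `<=` le_rel v.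
Proof.
move=> LLL cv vL; apply: le_rel_Grel => //.
apply: hat_rel_min => //; first exact: closed_le_rel.
by move=> x y fxy; rewrite /le_rel /= !vL; have [_] := LLf LLL; apply.
Qed.

Lemma LL_extends L : LL L -> exists2 v : Y -> R, continuous v & forall x, v (i x) = L x.
Proof. by move=> LLL; apply: algebra_extends; apply: sub_gen_smallest; left. Qed.

Lemma hat_Grel_neq x y : x <> y ->
  Grel (hat_rel i f) (i x, i y) -> Grel f (x, y).
Proof.
move=> xy hxy; case: LLs => _ fE.
have : (diagonal `|` Grel f) (x, y).
  rewrite fE => L LLL; have [v cv vL] := LL_extends LLL.
  by have := hat_Grel_lyapunov LLL cv vL hxy; rewrite /le_rel /= !vL.
by case=> // /diagonalP.
Qed.

Lemma hat_GrelE x y : Grel (hat_rel i f) (i x, i y) <-> Grel f (x, y).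
Proof.
split; last exact: (Grel_sub_hat Yi (p := (x, y))).
have [<-|/eqP xy] := eqVneq x y; last exact: hat_Grel_neq.
have ch : closed (hat_rel i f) by exact: closed_closure.
(* Sufficiency says nothing on the diagonal. The first step from [x] ends at some [z] in [X]: either
   [z] is [x], or the rest of the chain is off the diagonal. *)
move=> /(Grel_first_step cY ch)[|[c]].
  move=> /(hat_rel_plus_proper hX lX Yi pf)[y' fxy' /(embedding_inj Yi) y'x].
  by apply: sub_gen_smallest; rewrite -{2}y'x.
move=> /(hat_rel_plus_proper hX lX Yi pf)[z fxz <-] zx.
have Gxz : Grel f (x, z) by exact: sub_gen_smallest.
have [zE|/eqP nzx] := eqVneq z x; first by rewrite -{2}zE.
by apply: Grel_trans Gxz _; exact: hat_Grel_neq.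
Qed.

Lemma lyapunov_dynamic : dynamic_compactification i f.
Proof. by split=> //; apply/seteqP; split=> -[x y] /hat_GrelE. Qed.

End LyapunovCompactification.

(** * Classes of the extended relation *)

Section Classes.
Variables (R : realType) (X Y : topologicalType) (i : X -> Y).
Hypothesis hX : hausdorff_space X.
Hypothesis lX : locally_compact [set: X].
Variables (f : set (X * X)) (LL : set (X -> R)).
Hypothesis LLs : sufficient f LL.
Hypothesis YL : lyapunov_compactification i LL.
Hypothesis pf : plus_proper f.

Let LLf : LL `<=` lyapunov f. Proof. by case: LLs. Qed.
Let Yi : proper_compactification i. Proof. by case: YL. Qed.
Let cY : compact [set: Y]. Proof. by case: Yi. Qed.
Let hY : hausdorff_space Y. Proof. by case: Yi. Qed.
Let hf := hat_rel i f.
Let hatE := hat_GrelE hX lX LLf YL LLs pf.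

(* A step of [f] leaving [W] lands in the compact set [f(W)], so that every
   [Grel hf]-chain from the interior of [W] to the outside of [W] passes
   through [(W `|` f(W)) `\` W°]. *)
Lemma hat_exit W a b : compact W -> W° a -> ~ (i @` W) b ->
  Grel hf (i a, b) ->
  exists z, [/\ ~ W° z, Grel hf (i a, i z) & i z = b \/ Grel hf (i z, b)].
Proof.
move=> cW Wa Wb hab; have [_ fK] := pf.
pose T := i @` ((W `|` rel_image f W) `&` ~` W°).
have cT : closed T.
  apply: compact_embedding_closed => //; apply: compact_closedI.
    by apply: compactU => //; exact: fK.
  exact/open_closedC/open_interior.
have ch : closed (Grel hf) by exact: closed_Grel.
have cWc : closed (~` (i @` W°)).
  apply: open_closedC; rewrite openE => _ [x Wx <-].
  by apply: embedding_nbhs => //; apply: open_nbhs_nbhs; split=> //; exact: open_interior.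
have cW' : closed (i @` W) by exact: compact_embedding_closed.
(* The diagonal is included because the point of [T] may be the end of the chain. *)
pose k := @diagonal Y `|` Grel hf.
have ck : closed k by apply: closedU => //; exact: closed_diagonal.
pose Q := [set p : Y * Y | exists2 z, T z & Grel hf (p.1, z) /\ k (z, p.2)].
(* [h] keeps the pairs that pass through [T] whenever they lead from the interior of [W] to the
   outside of [W]. It is shown to be closed, transitive and to contain [hat_rel i f]. *)
pose h := Grel hf `&` ((fst @^-1` (~` (i @` W°)) `|` snd @^-1` (i @` W)) `|` Q).
have : Grel hf `<=` h.
  apply: Grel_min.
  - apply: closedI => //; apply: closedU; first apply: closedU.
    + have /continuous_closedP : continuous (@fst Y Y) by move=> p; exact: cvg_fst.
      exact.
    + have /continuous_closedP : continuous (@snd Y Y) by move=> p; exact: cvg_snd.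
      exact.
    + exact: closed_rel_comp.
  - move=> x y z [xy xyW] [yz yzW]; split; first exact: Grel_trans xy yz.
    have [Wx|Wx] := pselect ((i @` W°) x); last by left; left.
    have [Wz|Wz] := pselect ((i @` W) z); first by left; right.
    (* If [y] is outside [W], the first pair passes through [T]; if [y] is in the interior, the
       second does; otherwise [y] itself is in [T]. *)
    right; have [[y0 Wy y0y]|Wy] := pselect ((i @` W) y); last first.
      case: xyW => [[//|//]|[t Tt [/= xt ty]]]; exists t => //; split=> //=.
      by right; case: ty => [/diagonalP -> //|ty]; exact: Grel_trans yz.
    have [Wy'|Wy'] := pselect ((i @` W°) y).
      case: yzW => [[//|//]|[t Tt [/= yt tz]]]; exists t => //; split=> //=.
      exact: Grel_trans yt.
    exists y; last by split=> //=; right.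
    exists y0 => //; split; first by left.
    by move=> Wy0; apply: Wy'; exists y0.
  - move=> [x y] xy; split; first exact: sub_gen_smallest.
    have [[x0 Wx x0x]|Wx] := pselect ((i @` W°) x); last by left; left.
    have [Wy|Wy] := pselect ((i @` W) y); first by left; right.
    right; subst x; have [y0 fxy0 y0y] := hat_rel_plus_proper hX lX Yi pf xy.
    subst y; exists (i y0); last by split=> /=; [exact: sub_gen_smallest|left].
    exists y0 => //; split.
      by right; exists x0; [exact: interior_subset|exact/xsectionP].
    by move=> Wy0; apply: Wy; exists y0 => //; exact: interior_subset.
move=> /(_ _ hab)[_ [[nWa|//]|]]; first by exfalso; apply: nWa; exists a.
by move=> [_ [z [_ Wz] <-] [/= az zb]]; exists z.
Qed.

Lemma class_trichotomy (E : set Y) : Gclass hf E ->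
  exactly_one_of_three (class_at_infinity i E)
    (class_one_point_compactification i f E) (class_compact i f E).
Proof.
move=> [y yy EE].
have inE z : E z <-> Grel hf (y, z) /\ Grel hf (z, y).
  by rewrite EE; split=> [/xsectionP[]|[? ?]]; [|apply/xsectionP].
have EG a b : E a -> E b -> Grel hf (a, b).
  by move=> /inE[_ ay] /inE[yb _]; exact: Grel_trans ay yb.
have EG' a b : E a -> Grel hf (a, b) -> Grel hf (b, a) -> E b.
  move=> /inE[ya ay] ab ba; apply/inE.
  by split; [exact: Grel_trans ya ab|exact: Grel_trans ba ay].
have Ey : E y by apply/inE.
have cE : closed E.
  rewrite EE; apply: closed_xsection; apply: closedI; first exact: closed_Grel.
  by apply: closed_swap; exact: closed_Grel.
have fixE : i @^-1` E `<=` rel_fix (Grel f).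
  by move=> x Ex; apply/hatE; exact: EG.
have classE x : E (i x) -> Gclass f (i @^-1` E).
  move=> Ex; exists x; first exact: fixE.
  apply/seteqP; split=> z.
    by move=> Ez; apply/xsectionP; split; apply/hatE; exact: EG.
  by move=> /xsectionP[xz zx]; apply: EG' Ex _ _; exact/hatE.
have infE p q : E p -> E q -> ~ range i p -> ~ range i q -> p = q.
  move=> Ep Eq pX qX; apply: (separate_at_infinity LLf YL pX qX).
  move=> L v LLL cv vL; have hv := hat_Grel_lyapunov LLf LLL cv vL.
  by apply/le_anti/andP; split; [exact: hv (EG _ _ Ep Eq)|exact: hv (EG _ _ Eq Ep)].
(* The three cases correspond to [E] inside [X], [E] disjoint from [X], and [E] meeting both [X] and
   its complement. *)
have [[p [Ep pX]]|EX] := pselect (exists p, E p /\ ~ range i p); last first.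
  have EE' : E = i @` (i @^-1` E).
    apply/seteqP; split=> [z Ez|_ [x Ex <-]//].
    have [x _ xz] : range i z by apply: contrapT => nz; apply: EX; exists z.
    by exists x => //; rewrite /preimage /= xz.
  have cptE : compact (i @^-1` E).
    apply: compact_embedding_preimage => //; first exact: subclosed_compact cY _.
    by rewrite EE' => _ [x _ <-]; exists x.
  have [x Ex] : exists x, E (i x) by move: Ey; rewrite EE' => -[x Ex _]; exists x.
  apply: Or33; split.
  - by move=> [p pX Ep]; apply: pX; exists x => //; move: Ex; rewrite Ep.
  - by move=> [_ _ /(_ cptE)].
  - by split=> //; exact: classE Ex.
have [[x Ex]|Xx] := pselect (exists x, E (i x)); last first.
  apply: Or31; split.
  - exists p => //; apply/seteqP; split=> [z Ez|_ ->//].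
    apply: infE => // -[x _ xz]; apply: Xx; exists x; by rewrite xz.
  - move=> [_ [x xx EEx] _ _ _]; apply: Xx; exists x.
    by rewrite -[E _]/((i @^-1` E) x) EEx; apply/xsectionP.
  - move=> [_ _ [x xx EEx] _]; apply: Xx; exists x.
    by rewrite -[E _]/((i @^-1` E) x) EEx; apply/xsectionP.
have EDp : E `\` i @` (i @^-1` E) = [set p].
  apply/seteqP; split=> [z [Ez nz]|_ ->].
    apply: infE => // -[x' _ x'z]; apply: nz; exists x' => //.
    by rewrite /preimage /= x'z.
  by split=> // -[x' _ x'p]; apply: pX; exists x'.
have ncE : ~ compact (i @^-1` E).
  (* A chain from [x] to [p] meets a point [z] of [X] outside the interior of [W]. As [p] leads back
     to [x], [z] is in [E], yet [E] ∩ [X] lies in that interior. *)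
  move=> cptE; have [W [cW EW _]] := compact_nbhd hX lX cptE openT (@subsetT _ _).
  have [z [nWz xz zp]] : exists z,
      [/\ ~ W° z, Grel hf (i x, i z) & i z = p \/ Grel hf (i z, p)].
    apply: (hat_exit cW); [exact: EW| |exact: EG].
    by move=> [w _ wp]; apply: pX; exists w.
  case: zp => [zp|zp]; first by apply: pX; exists z.
  apply: nWz; apply: EW; apply: (EG' _ _ Ex xz).
  exact: Grel_trans zp (EG _ _ Ep Ex).
apply: Or32; split.
- by move=> [q qX Eq]; apply: qX; exists x => //; move: Ex; rewrite Eq.
- split=> //; [exact: classE Ex| |by exists p].
  apply/seteqP; split.
    by rewrite [X in _ `<=` X](closure_id E).1//; apply: closureS => _ [z Ez <-].
  move=> z Ez; have [[x' _ x'z]|zX] := pselect (range i z).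
    by apply: subset_closure; exists x' => //; rewrite /preimage /= x'z.
  (* If [p] were not in the closure, that closure would lie in [X] and be compact with trace [E] ∩
     [X], against [ncE]. *)
  rewrite (infE _ _ Ez Ep)//; apply: contrapT => pE; apply: ncE.
  pose C := closure (i @` (i @^-1` E)).
  have CE : C `<=` E.
    by rewrite [X in _ `<=` X](closure_id E).1//; apply: closureS => _ [w Ew <-].
  have -> : i @^-1` E = i @^-1` C.
    by apply/seteqP; split=> w; [move=> Ew; apply: subset_closure; exists w|exact: CE].
  apply: compact_embedding_preimage => //.
    by apply: subclosed_compact cY _ => //; exact: closed_closure.
  move=> w Cw; apply: contrapT => wX; apply: pE.
  by rewrite -(infE _ _ (CE _ Cw) Ep).
- by move=> [_ _ _ /ncE].
Qed.

End Classes.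

(** * The Gelfand compactification *)

Section SetType.
Variables (T : topologicalType) (C : set T).

Lemma nbhs_set_val (y : C) (B : set C) : nbhs y B <->
  exists2 W, nbhs (set_val y) W & set_val @^-1` W `<=` B.
Proof.
split=> [[V [[W oW <-] Wy WB]]|[W yW WB]].
  by exists W => //; exact: open_nbhs_nbhs.
apply: filterS WB _; exact: (@initial_continuous _ _ set_val).
Qed.

Lemma set_val_inj : injective (set_val : C -> T).
Proof. exact: val_inj. Qed.

Lemma compact_set_type : compact C -> compact [set: C].
Proof.
move=> cC F PF _; have [|c [Cc Fc]] := cC (set_val @ F) _.
  by apply: (@filterS _ F _ setT); [move=> y _; exact: set_valP|exact: filterT].
exists (exist _ c (mem_set Cc)); split=> // A B FA /nbhs_set_val[W cW WB].
have [||_ [[a Aa <-] Wa]] := Fc (set_val @` A) W => //.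
  by apply: (@filterS _ F _ A) => // a Aa; exists a.
by exists a; split=> //; exact: WB.
Qed.

Lemma hausdorff_set_type : hausdorff_space T -> hausdorff_space C.
Proof.
move=> hT x y xy; apply: set_val_inj; apply: hT => A B xA yB.
have [||z [Az Bz]] := xy (set_val @^-1` A) (set_val @^-1` B).
- by apply/nbhs_set_val; exists A.
- by apply/nbhs_set_val; exists B.
- by exists (set_val z).
Qed.

End SetType.

(** Stone-Weierstrass applies to the continuous functions on [Y] whose restriction is in [A]: they
    form a closed algebra separating points, hence are all continuous functions. *)
Lemma extendable_algebra (R : realType) (X Y : topologicalType) (i : X -> Y)
    (A : set (X -> R)) :
  compact [set: Y] -> closed_subalgebra A ->
  (forall u, A u -> exists2 v : Y -> R, continuous v & forall x, v (i x) = u x) ->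
  (forall x y, x <> y -> exists v : Y -> R,
     [/\ continuous v, A (v \o i) & v x <> v y]) ->
  extendable R i = A.
Proof.
move=> cY [Ab Ac As Am /closed_uniformP Acl] Aext Asep.
apply/seteqP; split=> [u [_ [v cv vu]]|u Au]; last by split; [exact: Ab|exact: Aext].
pose B := [set w : Y -> R | continuous w /\ A (w \o i)].
suff [_] : B v by rewrite (_ : v \o i = u)//; apply/funext.
apply: (stone_weierstrass cY) => //.
- by move=> w [].
- by move=> c; split; [exact: cst_continuous|exact: Ac].
- move=> c w [cw Aw]; split; last exact: As Aw.
  by move=> y; apply: cvgM; [exact: cvg_cst|exact: cw].
- move=> w1 w2 [cw1 Aw1] [cw2 Aw2]; split; last by have [] := Am _ _ Aw1 Aw2.
  by move=> y; apply: cvgD; [exact: cw1|exact: cw2].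
- move=> w1 w2 [cw1 Aw1] [cw2 Aw2]; split; last by have [] := Am _ _ Aw1 Aw2.
  by move=> y; apply: cvgM; [exact: cw1|exact: cw2].
- move=> w cw wB; split=> //; apply: Acl => e /wB[w' [_ Aw'] ww'].
  by exists (w' \o i) => // x; exact: ww'.
- by move=> x y /Asep[w [cw Aw wxy]]; exists w.
Qed.

Section Gelfand.
Variables (R : realType) (X : topologicalType).
Variable A : set (X -> R).
Hypothesis subA : closed_subalgebra A.
Hypothesis bump : forall x O, nbhs x O -> exists2 c : X -> R, A c &
  c x = 1 /\ forall y, ~ O y -> c y = 0.
Hypothesis hX : hausdorff_space X.

Definition gelfand_index : choiceType := {classic {u : X -> R | A u}}.
Definition gelfand_product : topologicalType :=
  prod_topology (fun _ : gelfand_index => R : topologicalType).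
Definition gelfand_eval (x : X) : gelfand_product := fun u => sval u x.
Definition gelfand_space : topologicalType := closure (range gelfand_eval).

Lemma gelfand_evalP x : closure (range gelfand_eval) (gelfand_eval x).
Proof. by apply: subset_closure; exists x. Qed.

Definition gelfand_embed (x : X) : gelfand_space :=
  exist _ (gelfand_eval x) (mem_set (@gelfand_evalP x)).

Definition gelfand_coord (u : gelfand_index) (y : gelfand_space) : R :=
  (set_val y : gelfand_product) u.

Lemma gelfand_coordE u x : gelfand_coord u (gelfand_embed x) = sval u x.
Proof. by []. Qed.

Lemma gelfand_coord_continuous u : continuous (gelfand_coord u).
Proof.
move=> y; apply: (@continuous_comp _ _ _ set_val (fun p : gelfand_product => p u)).
  exact: (@initial_continuous _ _ set_val).
exact: (@proj_continuous gelfand_index (fun=> R : topologicalType) u).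
Qed.

Lemma gelfand_eval_continuous : continuous gelfand_eval.
Proof.
move=> x; apply/cvg_sup => u W [_ [[V oV <-] Vx VW]].
rewrite nbhs_filterE; apply: filterS VW _.
have [Ab _ _ _ _] := subA; have [cu _] := Ab _ (svalP u).
by apply: cu; apply: open_nbhs_nbhs.
Qed.

Lemma gelfand_embed_continuous : continuous gelfand_embed.
Proof.
move=> x B /nbhs_set_val[W xW WB]; apply: filterS WB _.
exact: gelfand_eval_continuous.
Qed.

Lemma gelfand_product_hausdorff : hausdorff_space gelfand_product.
Proof.
apply: (@hausdorff_product gelfand_index (fun=> R : topologicalType)) => _.
exact: Rhausdorff.
Qed.

Lemma gelfand_compact : compact [set: gelfand_space].
Proof.
apply: compact_set_type; have [Ab _ _ _ _] := subA.
have /choice[M MP] : forall u : gelfand_index, exists M, forall x, `|sval u x| <= M.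
  by move=> u; apply/bounded_fun_normP; have [] := Ab _ (svalP u).
pose K := [set p : gelfand_product | forall u, `[- M u, M u]%classic (p u)].
have cK : compact K.
  apply: (@tychonoff gelfand_index (fun=> R : topologicalType)
    (fun u => `[- M u, M u]%classic)) => u; exact: segment_compact.
apply: (subclosed_compact _ cK); first exact: closed_closure.
rewrite [X in _ `<=` X](closure_id K).1.
  by apply: closureS => _ [x _ <-] u; rewrite /= in_itv /= -ler_norml; exact: MP.
by apply: compact_closed cK; exact: gelfand_product_hausdorff.
Qed.

Lemma gelfand_proper : proper_compactification gelfand_embed.
Proof.
split.
- exact: gelfand_compact.
- exact/hausdorff_set_type/gelfand_product_hausdorff.
- split.
    move=> x y xy; apply: hX => U V xU yV; apply: contrapT => UV.
    have [c Ac [cx cU]] := bump xU.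
    have cxy : c x = c y.
      by have := congr1 (gelfand_coord (exist _ c Ac)) xy.
    have : U y by apply: contrapT => /cU; rewrite -cxy cx => /eqP; rewrite oner_eq0.
    by move=> Uy; apply: UV; exists y; split=> //; exact: nbhs_singleton.
  apply/seteqP; split=> [U oU|_ [V oV <-]]; last first.
    by move/continuousP: gelfand_embed_continuous; apply.
  (* An open set [U] is the trace of the union of the sets where a coordinate vanishing off [U] is
     positive; the bumps show that this union reaches every point of [U]. *)
  pose D := [set u : gelfand_index | forall y, ~ U y -> sval u y = 0].
  exists (\bigcup_(u in D) gelfand_coord u @^-1` [set r | 0 < r]).
    apply: bigcup_open => u _.
    move/continuousP: (@gelfand_coord_continuous u); apply; exact: open_gt.
  apply/seteqP; split=> [x [u Du ux]|x Ux].
    apply: contrapT => /Du xu; move: ux.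
    by rewrite /preimage /mkset gelfand_coordE xu ltxx.
  have [|c Ac [cx cU]] := @bump x U; first exact: open_nbhs_nbhs.
  by exists (exist _ c Ac) => //; rewrite /preimage /mkset gelfand_coordE /= cx.
- move=> O [y Oy] oO.
  have /nbhs_set_val[W yW WO] : nbhs y O by exact: open_nbhs_nbhs.
  have [_ [[x _ <-] Wx]] := set_valP y W yW.
  by exists (gelfand_embed x); split; [exact: WO|exists x].
Qed.

Lemma gelfand_associated : associated_compactification gelfand_embed A.
Proof.
split; first exact: gelfand_proper.
apply: extendable_algebra => //.
- exact: gelfand_compact.
- move=> u Au; exists (gelfand_coord (exist _ u Au)) => //.
  exact: gelfand_coord_continuous.
- move=> x y xy; have [j jxy] : exists j, gelfand_coord j x <> gelfand_coord j y.
    apply: contrapT => /forallNP h; apply: xy; apply: set_val_inj; apply/funext => j.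
    by apply: contrapT; exact: h.
  exists (gelfand_coord j); split=> //; first exact: gelfand_coord_continuous.
  exact: svalP j.
Qed.

End Gelfand.

(** * Metrizability *)

Section SeparatingMetric.
Variables (R : realType) (Y : topologicalType) (v : nat -> Y -> R).
Hypothesis v_sep : forall x y, (forall n, v n x = v n y) -> x = y.

Let t n x y := Num.min (2^-1 ^+ n) `|v n x - v n y|.

(** The caps [2^-1 ^+ n] leave only finitely many terms to control at a given scale, and a supremum
    replaces the usual series. *)
Definition sep_dist x y := sup (range (fun n => t n x y)).

Let half_gt0 n : 0 < 2^-1 ^+ n :> R.
Proof. by rewrite exprn_gt0// invr_gt0. Qed.

Let t_le1 n x y : t n x y <= 1.
Proof. by rewrite /t ge_min exprn_ile1 ?invr_ge0 ?invf_le1 ?ler1n. Qed.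

Let t_le n x y : t n x y <= sep_dist x y.
Proof.
by apply: ub_le_sup; [exists 1 => _ [k _ <-]; exact: t_le1|exists n].
Qed.

Let sep_dist_le x y c : (forall n, t n x y <= c) -> sep_dist x y <= c.
Proof.
by move=> tc; apply: ge_sup; [exists (t 0 x y), 0%N|move=> _ [n _ <-]].
Qed.

Lemma sep_distxx x : sep_dist x x = 0.
Proof.
have t0 n : t n x x = 0 by rewrite /t subrr normr0 min_r// ltW.
apply/le_anti/andP; split; first by apply: sep_dist_le => n; rewrite t0.
by rewrite -(t0 0%N).
Qed.

Lemma sep_dist_eq0 x y : sep_dist x y = 0 -> x = y.
Proof.
move=> d0; apply: v_sep => n; have := t_le n x y.
rewrite d0 /t ge_min leNgt half_gt0 /= normr_le0 subr_eq0.
by move/eqP.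
Qed.

Lemma sep_dist_sym x y : sep_dist x y = sep_dist y x.
Proof.
rewrite /sep_dist (_ : (fun n => t n x y) = fun n => t n y x)//.
by apply/funext => n; rewrite /t distrC.
Qed.

Lemma sep_dist_triangle y x z : sep_dist x z <= sep_dist x y + sep_dist y z.
Proof.
apply: sep_dist_le => n; apply: le_trans (lerD (t_le n x y) (t_le n y z)).
have := ler_distD (v n y) (v n x) (v n z); have := half_gt0 n.
have := normr_ge0 (v n x - v n y); have := normr_ge0 (v n y - v n z).
rewrite /t /Num.min; case: ifP => ?; case: ifP => ?; case: ifP => ?; lra.
Qed.

(* The idle [let] makes the instance below depend on [v_sep]. *)
Definition sep_metric : Type := let _ := v_sep in Y.
HB.instance Definition _ := Choice.copy sep_metric Y.
HB.instance Definition _ := @isMetric.Build R sep_metric sep_dist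
  sep_distxx sep_dist_eq0 sep_dist_sym sep_dist_triangle.

Hypothesis cY : compact [set: Y].
Hypothesis v_cont : forall n, continuous (v n).

Lemma sep_dist_near x (e : R) : 0 < e -> \forall y \near x, sep_dist x y < e.
Proof.
move=> e0; have e2 : 0 < e / 2 by rewrite divr_gt0.
have [N Ne] := half_expr_small e2.
have : \forall y \near x, forall n, (n < N)%N -> `|v n x - v n y| <= e / 2.
  elim: N {Ne} => [|N IH]; first by near=> y.
  have /cvgrPdist_le/(_ _ e2) := @v_cont N x.
  apply: filterS2 IH => y IH vN n; rewrite ltnS leq_eqVlt => /predU1P[->//|].
  exact: IH.
apply: filterS => y vy; apply: (@le_lt_trans _ _ (e / 2)); last first.
  by rewrite ltr_pdivrMr// ltr_pMr// ltr1n.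
apply: sep_dist_le => n; rewrite /t ge_min.
have [nN|Nn] := ltnP n N; first by rewrite vy ?orbT.
rewrite (le_trans _ Ne)// ler_wiXn2l// ?invr_ge0//.
by rewrite invf_le1// ler1n.
Unshelve. all: by end_near. Qed.

(** The identity to the metric topology is a continuous bijection from a compact space to a
    Hausdorff one, hence a homeomorphism. *)
Lemma separating_metrizable : metrizable R Y.
Proof.
pose h : Y -> sep_metric := id; exists sep_metric, h.
have ch : continuous h.
  move=> x B /nbhs_ballP[e /= e0 eB]; rewrite nbhs_filterE.
  apply: filterS (sep_dist_near x e0) => y xy; apply: eB.
  by rewrite ballEmdist.
split; last by apply/seteqP; split=> // x _; exists x.
split; first by move=> x y.
apply/seteqP; split=> [U oU|_ [V oV <-]]; last by move/continuousP: ch; apply.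
exists U => //; rewrite -closedC.
have -> : ~` U = h @` (~` U).
  by apply/seteqP; split=> [x Ux|_ [x Ux <-]//]; exists x.
apply: compact_closed; first exact: (@metric_hausdorff R sep_metric).
apply: compact_image => //; apply: subclosed_compact cY _ => //.
exact: open_closedC.
Qed.

End SeparatingMetric.

(** * Countable bases of metrizable sigma-compact spaces *)

Section CountableBase.
Variables (R : realType) (X : topologicalType).

(** The sets need not be open; it is enough that one of them is a neighborhood of the given
    point. *)
Definition countable_base (T : countType) (B : T -> set X) :=
  forall (x : X) O, nbhs x O -> exists n, nbhs x (B n) /\ B n `<=` O.

(** Each [K j] is covered by finitely many balls of radius [2^-1 ^+ k]; the index [(j, k, l)] refers
    to the [l]-th of them. *)
Lemma metrizable_countable_base : metrizable R X -> sigma_compact X ->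
  exists B : nat * nat * nat -> set X, countable_base B.
Proof.
move=> [M [h [[_ oE] _]]] [K cK KX].
have ch : continuous h by apply/continuousP => V oV; rewrite oE; exists V.
pose U k c : set X := (h @^-1` ball (h c) (2^-1 ^+ k))°.
have xU k x : nbhs x (U k x).
  apply: nbhs_interior; apply: ch; apply: nbhsx_ballx.
  by rewrite exprn_gt0// invr_gt0.
have /choice[s sP] : forall jk : nat * nat, exists s : seq X,
    forall y, K jk.1 y -> exists2 c, c \in s & U jk.2 c y.
  move=> [j k]; have [|||||s _ sP] := compact_directed (T := seq X) (cK j) (D := setT)
    (le := fun s s' => {subset s <= s'}) (P := fun s y => exists2 c, c \in s & U k c y).
  - by move=> a b c ab bc z /ab/bc.
  - by exists [::].
  - move=> a b _ _; exists (a ++ b) => //.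
    by split=> z zs; rewrite mem_cat zs ?orbT.
  - by move=> a b y ab [c /ab cb Uc]; exists c.
  - move=> y _; exists [:: y] => //; apply: filterS (xU k y) => z Uz.
    by exists y => //; rewrite mem_head.
  - by exists s.
(* Beyond the end of the list [onth] gives [None] and the set is empty. *)
exists (fun jkl => [set y | exists2 c, onth (s jkl.1) jkl.2 = Some c & U jkl.1.2 c y]).
move=> x O xO; have [Z [oZ Zx] ZO] : exists2 Z, open_nbhs x Z & Z `<=` O.
  by move: xO; rewrite nbhsE.
move: oZ; rewrite oE => -[V oV VZ].
have /nbhs_ballP[e /= e0 eV] : nbhs (h x) V.
  by apply: open_nbhs_nbhs; split=> //; rewrite -[V _]/((h @^-1` V) x) VZ.
have e2 : 0 < e / 2 by rewrite divr_gt0.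
have [k ke] := half_expr_small e2.
have [j Kj] : exists j, K j x by have : setT x by []; rewrite -KX => -[j]; exists j.
have [c /(nthP x)[l ls sl] Uc] := sP (j, k) x Kj.
have sc : onth (s (j, k)) l = Some c by rewrite onthE (nth_map x)// sl.
exists (j, k, l); split=> /=.
  have xUc : nbhs x (U k c) by apply: open_nbhs_nbhs; split=> //; exact: open_interior.
  by apply: (filterS _ xUc) => y Uy; exists c.
move=> y [c']; rewrite sc => -[<-] Uy; apply: ZO; rewrite -VZ; apply: eV.
have ke2 : 2^-1 ^+ k + 2^-1 ^+ k <= e by rewrite [e]splitr; exact: lerD.
apply: (le_ball ke2); apply: (@ball_triangle _ _ (h c)).
  by apply: ball_sym; exact: (interior_subset Uc).
exact: (interior_subset Uy).
Qed.

End CountableBase.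

(** * Countable sufficient sets *)

Section CountableLyapunov.
Variables (R : realType) (X : topologicalType) (f : set (X * X)).
Variables (T : countType) (B : T -> set X).
Hypothesis Bbase : countable_base B.

(** For each pair of base sets, one Lyapunov function larger on the first than on the second is
    selected, if there is any. When [M y < M x], base sets on the two sides of the mean value show
    that a selected function also separates [x] from [y]. *)
Lemma countable_sufficient : sufficient f (@lyapunov R X f) ->
  exists L : T * T -> X -> R, sufficient f (range L).
Proof.
move=> [_ fE]; pose S nm (L : X -> R) :=
  forall x y, B nm.1 x -> B nm.2 y -> L y < L x.
have /choice[L LP] : forall nm : T * T, exists L : X -> R, lyapunov f L /\
    ((exists2 L', lyapunov f L' & S nm L') -> S nm L).
  move=> nm; have [[L Ll LS]|nL] := pselect (exists2 L, @lyapunov R X f L & S nm L).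
    by exists L.
  (* A harmless Lyapunov function for pairs that cannot be separated. *)
  exists (cst 0); split=> //; split=> //; split; first exact: cst_continuous.
  by apply/bounded_fun_normP; exists 0 => x; rewrite normr0.
exists L; have Ll : range L `<=` lyapunov f by move=> _ [nm _ <-]; have [] := LP nm.
split=> //; rewrite fE; apply/seteqP; split=> [p h M /Ll /h//|[x y] h M Ml].
rewrite /le_rel /= leNgt; apply/negP => Myx.
have [[cM _] _] := Ml; pose c := (M x + M y) / 2.
have xc : nbhs x [set z | c < M z].
  by apply: (cvgr_gt (M x)); [exact: cM|rewrite /c; lra].
have yc : nbhs y [set z | M z < c].
  by apply: (cvgr_lt (M y)); [exact: cM|rewrite /c; lra].
have [n [xn nc]] := Bbase xc; have [m [ym mc]] := Bbase yc.
have [_ LS] := LP (n, m).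
have : S (n, m) (L (n, m)).
  by apply: LS; exists M => // z w /= /nc zc /mc wc; exact: lt_trans zc.
move=> /(_ x y (nbhs_singleton xn) (nbhs_singleton ym)).
apply/negP; rewrite -leNgt.
by apply: (h (L (n, m))); exists (n, m).
Qed.

Hypothesis hX : hausdorff_space X.
Hypothesis lX : locally_compact [set: X].
Hypothesis sX : sigma_compact X.

(** Same selection, for functions positive on the first base set and zero off the second. Positivity
    suffices to separate, and it persists on a neighborhood. *)
Lemma countable_bumps : exists c : T * T -> X -> R,
  (forall nm, compactly_supported (c nm)) /\
  forall x O, nbhs x O -> exists nm, 0 < c nm x /\ forall y, ~ O y -> c nm y = 0.
Proof.
pose S nm (c : X -> R) :=
  (forall x, B nm.1 x -> 0 < c x) /\ forall y, ~ B nm.2 y -> c y = 0.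
have /choice[c cP] : forall nm : T * T, exists c : X -> R, compactly_supported c /\
    ((exists2 c', compactly_supported c' & S nm c') -> S nm c).
  move=> nm; have [[c cc cS]|nc] := pselect (exists2 c, @compactly_supported R X c & S nm c).
    by exists c.
  exists (cst 0); split=> //; split; first exact: cst_continuous.
  rewrite (_ : [set x | _] = set0) ?closure0; first exact: compact0.
  by apply/seteqP; split=> x //=; rewrite eqxx.
exists c; split=> [nm|x O xO]; first by have [] := cP nm.
have [m [xm mO]] := Bbase xO.
have [c' [cc' c'x c'0]] := compact_bump R hX lX sX xm.
have xc' : nbhs x [set z | 0 < c' z].
  by apply: (cvgr_gt (c' x)); [exact: cc'.1|rewrite c'x].
have [n [xn nc']] := Bbase xc'; exists (n, m); have [_ cS] := cP (n, m).
have [|cS1 cS2] := cS; first by exists c'.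
split; first exact: cS1 (nbhs_singleton xn).
by move=> y Oy; apply: cS2 => /mO.
Qed.

Variables (Y : topologicalType) (i : X -> Y) (J : countType) (L : J -> X -> R).
Hypothesis Ll : range L `<=` lyapunov f.
Hypothesis YL : lyapunov_compactification i (range L).

Let Yi : proper_compactification i. Proof. by case: YL. Qed.
Let cY : compact [set: Y]. Proof. by case: Yi. Qed.
Let hY : hausdorff_space Y. Proof. by case: Yi. Qed.

(** The extended bumps separate a point of [X] from every other point, and the extended Lyapunov
    functions separate points at infinity. *)
Lemma lyapunov_compactification_metrizable : metrizable R Y.
Proof.
have [c [cc cP]] := countable_bumps.
have /choice[vL vLP] : forall j, exists v : Y -> R,
    continuous v /\ forall x, v (i x) = L j x.
  move=> j; have [|v ? ?] := algebra_extends YL (u := L j); last by exists v.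
  by apply: sub_gen_smallest; left; exists j.
have /choice[vc vcP] : forall nm, exists v : Y -> R,
    continuous v /\ forall x, v (i x) = c nm x.
  move=> nm; have [|v ? ?] := algebra_extends YL (u := c nm); last by exists v.
  by apply: sub_gen_smallest; right.
(* Both families are listed in one sequence; numbers that code nothing give the zero function. *)
pose v k : Y -> R := match @unpickle (J + T * T)%type k with
  | Some (inl j) => vL j | Some (inr nm) => vc nm | None => cst 0 end.
apply: (@separating_metrizable R Y v) => //; last first.
  move=> k; rewrite /v; case: unpickle => [[j|nm]|]; last exact: cst_continuous.
  - by have [] := vLP j.
  - by have [] := vcP nm.
move=> x y vxy.
have vLxy j : vL j x = vL j y by have := vxy (pickle (inl j : J + T * T)); rewrite /v pickleK.
have vcxy nm : vc nm x = vc nm y.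
  by have := vxy (pickle (inr nm : J + T * T)); rewrite /v pickleK.
have sepX a z : (forall nm, vc nm (i a) = vc nm z) -> i a = z.
  move=> vaz; apply/eqP; apply: contrapT => /negP az.
  move: hY; rewrite open_hausdorff => /(_ _ _ az)[[U V] /= [aU zV] [oU oV /eqP UV0]].
  have aiU : nbhs a (i @^-1` U).
    by apply: embedding_continuous => //; apply: open_nbhs_nbhs; split=> //; exact: set_mem.
  have [nm [ca c0]] := cP _ _ aiU; have [cv vE] := vcP nm.
  (* The bump vanishes on the part of [X] in [V], hence, by density, at [z], while it is positive at
     [a]. *)
  have : closed ([set z | vc nm z = 0] `|` ~` V).
    apply: closedU; last exact: open_closedC.
    by move/continuous_closedP: cv => /(_ _ (@closed_eq R 0)).
  move=> /(dense_closed Yi)/(_ _ z)[b||]; last 2 first.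
  - by move=> vz; move: ca; rewrite -vE vaz vz ltxx.
  - by apply; exact: set_mem.
  have [Ub|Ub] := pselect (U (i b)); last by left; rewrite /= vE; exact: c0.
  right=> Vb; have : (U `&` V) (i b) by [].
  by rewrite UV0.
have [[a _ ax]|xX] := pselect (range i x).
  by rewrite -ax; apply: sepX => nm; rewrite ax.
have [[a _ ay]|yX] := pselect (range i y).
  by rewrite -ay; apply/esym/sepX => nm; rewrite ay.
apply: (separate_at_infinity Ll YL xX yX) => _ w [j _ <-] cw wL.
have [cv vE] := vLP j.
have wv : w =1 vL j by apply: (extension_unique YL) => // z; rewrite wL vE.
by rewrite !wv.
Qed.

End CountableLyapunov.

(** * Sufficiency, dynamic compactification, trichotomy of classes and metrizability together *)

Theorem theorem0p2 (R : realType) (X : topologicalType)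
    (hausdorffX : hausdorff_space X)
    (locally_compactX : locally_compact [set: X])
    (sigma_compactX : sigma_compact X)
    (f : set (X * X)) (closedf : closed f) (properf : plus_proper f) :
  [/\ sufficient f (@lyapunov R X f),
      forall LL : set (X -> R), sufficient f LL ->
        (exists (Xhat : topologicalType) (i : X -> Xhat),
          lyapunov_compactification i LL) /\
        (forall (Xhat : topologicalType) (i : X -> Xhat),
          lyapunov_compactification i LL -> dynamic_compactification i f),
      forall LL : set (X -> R), sufficient f LL ->
        forall (Xhat : topologicalType) (i : X -> Xhat),
          lyapunov_compactification i LL ->
        forall Ehat : set Xhat, Gclass (hat_rel i f) Ehat ->
          exactly_one_of_three
            (class_at_infinity i Ehat)
            (class_one_point_compactification i f Ehat)
            (class_compact i f Ehat) &
      metrizable R X ->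
        exists LL : set (X -> R),
          [/\ countable LL, sufficient f LL &
              forall (Xhat : topologicalType) (i : X -> Xhat),
                lyapunov_compactification i LL -> metrizable R Xhat]].
Proof.
have suff_f : sufficient f (@lyapunov R X f) by exact: lyapunov_sufficient.
split=> //.
- move=> LL LLs; have LLf : LL `<=` lyapunov f by case: LLs.
  split; last by move=> Xhat i iLL; exact: lyapunov_dynamic LLf iLL LLs properf.
  exists (gelfand_space (lyapunov_algebra LL)), (@gelfand_embed R X (lyapunov_algebra LL)).
  apply: gelfand_associated => //; first exact: lyapunov_algebra_closed LLf.
  move=> x O xO.
  (* The compactly supported functions alone make the algebra distinguish points from closed
     sets. *)
  have [c [cc c1 c0]] := compact_bump R hausdorffX locally_compactX sigma_compactX xO.
  by exists c => //; apply: sub_gen_smallest; right.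
- move=> LL LLs Xhat i iLL E.
  exact: (class_trichotomy hausdorffX locally_compactX LLs iLL properf).
- move=> mX; have [B Bbase] := metrizable_countable_base mX sigma_compactX.
  have [L Ls] := countable_sufficient Bbase suff_f.
  exists (range L); split=> //.
    by apply: sub_countable (card_image_le _ _) _; exact: countableP.
  move=> Xhat i iL; have [Ll _] := Ls.
  exact: (lyapunov_compactification_metrizable Bbase hausdorffX locally_compactX
    sigma_compactX Ll iL).
Qed.
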